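(* There is an algorithm that, given a finitely generated subgroup $H\le F_n$ and an element $g\in F_n$ that depends on $H$, produces a non-trivial equation $w\in\mathfrak I_g$ of minimum possible degree (i.e. of minimum degree among all non-trivial elements of $\mathfrak I_g$).
   Context: $F_n$ is the free group with basis $a_1,\dots,a_n$. For a finitely generated subgroup $H\le F_n$ let $\langle x\rangle\cong\mathbb Z$ be infinite cyclic. An equation with coefficients in $H$ is an element $w\in H*\langle x\rangle$; it has a unique expression as a reduced word in the alphabet $\{x,x^{-1}\}\cup (H\setminus\{1\})$. The degree of $w$ is the number of occurrences of $x$ and $x^{-1}$ in the cyclic reduction of $w$. For $g\in F_n$ let $\varphi_g:H*\langle x\rangle\to F_n$ be the homomorphism that is the inclusion on $H$ and sends $x$ to $g$, and let $\mathfrak I_g=\ker\varphi_g$, a normal subgroup of $H*\langle x\rangle$. We say $g$ depends on $H$ if $\mathfrak I_g$ is non-trivial. When an algorithm takes a finitely generated subgroup $H\le F_n$ as input, $H$ is given by a finite set of generators, each given as a word in the basis $a_1,\dots,a_n$. *)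

(* Defs.v *)
From HB Require Import structures.
From mathcomp Require Import all_boot.

Set Implicit Arguments.
Unset Strict Implicit.
Unset Printing Implicit Defensive.

Local Open Scope group_scope.

(** * The free group [F_n] *)

(** [(i, false)] is the basis element [a_i] and [(i, true)] its inverse. *)
Notation fletter n := ('I_n * bool)%type.

Notation fword n := (seq (fletter n)).

Section FreeGroup.
Variable n : nat.
Implicit Types (l k : fletter n) (s t u : fword n).

Definition finv l : fletter n := (l.1, ~~ l.2).

Definition freduced s := sorted (fun l k => k != finv l) s.

Definition fpush l s : fword n :=
  if s is k :: s' then if k == finv l then s' else l :: s else [:: l].

Definition freduce s : fword n := foldr fpush [::] s.

Lemma finvK : involutive finv.
Proof. by case=> i b; rewrite /finv /= negbK. Qed.

Lemma fpush_reduced l s : freduced s -> freduced (fpush l s).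
Proof.
case: s => //= k s; case: ifP => [_|]; first exact: path_sorted.
by move=> /negbT kl ks /=; rewrite kl.
Qed.

Lemma fpushK l s : freduced s -> fpush (finv l) (fpush l s) = s.
Proof.
case: s => [_|k s]; rewrite /= ?finvK ?eqxx //.
case: ifP => [/eqP-> |_ _] /=; last by rewrite finvK eqxx.
by case: s => [|j s] //= /andP[/negPf->].
Qed.

Lemma foldr_fpush_reduced s t : freduced t -> freduced (foldr fpush t s).
Proof. by move=> rt; elim: s => //= l s; apply: fpush_reduced. Qed.

Lemma freduce_reduced s : freduced (freduce s).
Proof. exact: foldr_fpush_reduced. Qed.

Lemma freduce_id s : freduced s -> freduce s = s.
Proof.
elim: s => //= l s IHs ls; rewrite IHs; last exact: path_sorted ls.
by case: s ls {IHs} => //= k s /andP[/negPf->].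
Qed.

Lemma foldr_fpush_push l s t : freduced s -> freduced t ->
  foldr fpush t (fpush l s) = fpush l (foldr fpush t s).
Proof.
move=> rs rt; case: s rs => //= k s _; case: ifP => // /eqP->.
by rewrite -{1}[l]finvK fpushK // foldr_fpush_reduced.
Qed.

Lemma foldr_fpush_foldr s t u : freduced t -> freduced u ->
  foldr fpush u (foldr fpush t s) = foldr fpush (foldr fpush u t) s.
Proof.
move=> rt ru; elim: s => //= l s IHs.
by rewrite foldr_fpush_push ?IHs // foldr_fpush_reduced.
Qed.

End FreeGroup.

Record free_group n := FreeGroup {
  fg_word :> fword n;
  fg_wordP : freduced fg_word }.

HB.instance Definition _ n := [isSub for @fg_word n].
HB.instance Definition _ n := [Choice of free_group n by <:].

Section FreeGroupTheory.
Variable n : nat.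
Implicit Types (a b c : free_group n) (s t : fword n).

Definition fg_of_word s : free_group n := FreeGroup (freduce_reduced s).

Definition fg_one : free_group n := fg_of_word [::].
Definition fg_mul a b : free_group n := fg_of_word (a ++ b).
Definition fg_inv a : free_group n := fg_of_word (rev (map (@finv n) a)).

Lemma fg_word_inj : injective (@fg_word n).
Proof. exact: val_inj. Qed.

Lemma fg_mulE a b : fg_word (fg_mul a b) = foldr (@fpush n) b a.
Proof. by rewrite /= /freduce foldr_cat -/(freduce b) freduce_id ?fg_wordP. Qed.

Lemma fg_of_wordK a : fg_of_word a = a.
Proof. by apply: val_inj; rewrite /= freduce_id ?fg_wordP. Qed.

Lemma fg_of_word_cat s t :
  fg_of_word (s ++ t) = fg_mul (fg_of_word s) (fg_of_word t).
Proof.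
apply: fg_word_inj; rewrite fg_mulE /= /freduce foldr_cat.
by rewrite foldr_fpush_foldr // freduce_reduced.
Qed.

Lemma fg_mulA : associative fg_mul.
Proof.
move=> a b c; apply: fg_word_inj.
by rewrite !fg_mulE foldr_fpush_foldr ?fg_wordP.
Qed.

Lemma fg_mul1g : left_id fg_one fg_mul.
Proof. by move=> a; rewrite -[RHS]fg_of_wordK. Qed.

Lemma fg_mulg1 : right_id fg_one fg_mul.
Proof. by move=> a; rewrite -[RHS]fg_of_wordK /fg_mul cats0. Qed.

Lemma freduce_invl s : freduce (rev (map (@finv n) s) ++ s) = [::].
Proof.
elim: s => //= l s IHs; rewrite rev_cons cat_rcons /freduce foldr_cat /=.
by rewrite fpushK -?foldr_cat ?IHs //; exact: freduce_reduced.
Qed.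

Lemma fg_mulVg : left_inverse fg_one fg_inv fg_mul.
Proof.
move=> a; rewrite -{2}[a]fg_of_wordK -fg_of_word_cat.
by apply: val_inj; rewrite /= freduce_invl.
Qed.

Lemma fg_mulgV : right_inverse fg_one fg_inv fg_mul.
Proof.
move=> a; rewrite -{1}[a]fg_of_wordK -fg_of_word_cat.
apply: val_inj => /=; have := freduce_invl (rev (map (@finv n) a)).
by rewrite map_rev revK (mapK (@finvK n)).
Qed.

HB.instance Definition _ := isGroup.Build (free_group n)
  fg_mulA fg_mul1g fg_mulg1 fg_mulVg fg_mulgV.

End FreeGroupTheory.

(** * Finitely generated subgroups *)

Inductive generated (G : groupType) (S : seq G) : G -> Prop :=
| generated_mem h : h \in S -> generated S h
| generated1 : generated S 1
| generatedM h k : generated S h -> generated S k -> generated S (h * k)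
| generatedV h : generated S h -> generated S h^-1.

(** * The free product of [G] and the infinite cyclic group on [x] *)

(** [inl false] is [x], [inl true] is its inverse and [inr h] is the element
    [h] of [G], which is only allowed in a reduced word if [h != 1]. *)
Notation letter G := (bool + G)%type.

Notation word G := (seq (letter G)).

Section FreeProduct.
Variable G : groupType.
Implicit Types (l : letter G) (s t u : word G) (h k : G).

Definition proper_letter l := if l is inr h then h != 1 else true.

Definition may_follow (l1 l2 : letter G) :=
  match l1, l2 with
  | inl b, inl c => b == c
  | inr _, inr _ => false
  | _, _ => true
  end.

Definition reduced s := all proper_letter s && sorted may_follow s.

Definition push l s : word G :=
  match l, s with
  | inl b, inl c :: s' => if b == c then l :: s else s'
  | inr h, inr k :: s' => if h * k == 1 then s' else inr (h * k) :: s'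
  | inr h, _ => if h == 1 then s else l :: s
  | _, _ => l :: s
  end.

Definition linv l : letter G :=
  match l with inl b => inl (~~ b) | inr h => inr h^-1 end.

Definition reduce s : word G := foldr push [::] s.

Lemma reduced_cons l s : reduced (l :: s) -> reduced s.
Proof. by case/andP=> /= /andP[_ ps] /path_sorted ss; apply/andP. Qed.

Lemma push_reduced l s : reduced s -> reduced (push l s).
Proof.
case: l s => [b|h] [|[c|k] s] //=.
- by case: eqP => [<-|_ /reduced_cons]//; rewrite /reduced /= eqxx.
- by case: eqP => //= /eqP h1; rewrite /reduced /= h1.
- by case: eqP => //= /eqP h1; rewrite /reduced /= h1.
- case: eqP => [_ /reduced_cons //|/eqP hk1].
  by case: s => [|[d|j] s]; rewrite /reduced /= hk1 // => /andP[/andP[_ ->] ->].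
Qed.

Lemma push_id l s : reduced (l :: s) -> push l s = l :: s.
Proof.
rewrite /reduced /=; case: l s => [b|h] [|[c|k] s] //=; rewrite ?andbF //.
- by case/andP=> _ /andP[->].
- by case: eqP.
- by case: eqP.
Qed.

Lemma push_x b s : reduced s -> push (inl (~~ b)) (push (inl b) s) = s.
Proof.
case: s => [|[c|h] s] rs /=; rewrite ?eqb_negl ?addbb //=.
- by case: b.
- case: (boolP (b == c)) => [/eqP ebc|nbc] /=; first by subst c; case: b rs.
  have -> : ~~ b = c by case: b c nbc {rs} => [] [].
  exact: push_id rs.
- by case: b.
Qed.

Lemma push_coef h k s : reduced s ->
  push (inr h) (push (inr k) s) = push (inr (h * k)) s.
Proof.
have base t : (if t is inr _ :: _ then false else true) ->
    push (inr h) (push (inr k) t) = push (inr (h * k)) t.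
  case: t => [_|[c|j] t _] //=.
  - by case: (eqVneq k 1) => [->|_] /=; rewrite ?mulg1.
  - by case: (eqVneq k 1) => [->|_] /=; rewrite ?mulg1.
case: s => [_|[c|j] s rs]; [exact: base|exact: base|] => /=.
case: (eqVneq (k * j) 1) => [kj1|_] /=; last by rewrite mulgA.
rewrite -mulgA kj1 mulg1.
case: s rs => [|[c|i] s] //; by rewrite /reduced /= andbF.
Qed.

Lemma push1 s : reduced s -> push (inr 1) s = s.
Proof.
case: s => [|[c|k] s] /=; rewrite ?eqxx // mul1g /reduced /=.
by move=> /andP[/andP[/negPf->]].
Qed.

Lemma pushK l s : reduced s -> push (linv l) (push l s) = s.
Proof.
case: l => [b|h] rs; first exact: push_x.
by rewrite /linv push_coef // mulVg push1.
Qed.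

Lemma foldr_push_reduced s t : reduced t -> reduced (foldr push t s).
Proof. by move=> rt; elim: s => //= l s; apply: push_reduced. Qed.

Lemma reduce_reduced s : reduced (reduce s).
Proof. exact: foldr_push_reduced. Qed.

Lemma reduce_id s : reduced s -> reduce s = s.
Proof.
elim: s => //= l s IHs ls.
by rewrite IHs ?(reduced_cons ls) // push_id.
Qed.

Lemma foldr_push_push l s t : reduced s -> reduced t ->
  foldr push t (push l s) = push l (foldr push t s).
Proof.
move=> rs rt; have rt' u : reduced (foldr push t u).
  by elim: u => //= k u; apply: push_reduced.
case: l s rs => [b|h] [|[c|k] s] rs //; rewrite [LHS]/=.
- case: (boolP (b == c)) => // nbc.
  have -> : b = ~~ c by case: b c nbc {rs} => [] [].
  rewrite (_ : foldr _ _ (inl c :: s) = push (inl c) (foldr push t s)) //.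
  by rewrite push_x.
- by case: (eqVneq h 1) => // ->; rewrite push1.
- by case: (eqVneq h 1) => // ->; rewrite push1.
- rewrite (_ : foldr _ _ (inr k :: s) = push (inr k) (foldr push t s)) //.
  rewrite push_coef //.
  by case: (eqVneq (h * k) 1) => // ->; rewrite push1.
Qed.

Lemma foldr_push_foldr s t u : reduced t -> reduced u ->
  foldr push u (foldr push t s) = foldr push (foldr push u t) s.
Proof.
move=> rt ru; elim: s => //= l s IHs.
by rewrite foldr_push_push ?IHs // foldr_push_reduced.
Qed.

End FreeProduct.

Record free_prod (G : groupType) := FreeProd {
  fp_word :> word G;
  fp_wordP : reduced fp_word }.

HB.instance Definition _ G := [isSub for @fp_word G].
HB.instance Definition _ G := [Choice of free_prod G by <:].

Section FreeProductTheory.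
Variable G : groupType.
Implicit Types (v w : free_prod G) (s t : word G).

Definition fp_of_word s : free_prod G := FreeProd (reduce_reduced s).

Definition fp_one : free_prod G := fp_of_word [::].
Definition fp_mul v w : free_prod G := fp_of_word (v ++ w).
Definition fp_inv v : free_prod G := fp_of_word (rev (map (@linv G) v)).

Lemma fp_word_inj : injective (@fp_word G).
Proof. exact: val_inj. Qed.

Lemma fp_mulE v w : fp_word (fp_mul v w) = foldr (@push G) w v.
Proof. by rewrite /= /reduce foldr_cat -/(reduce w) reduce_id ?fp_wordP. Qed.

Lemma fp_of_wordK v : fp_of_word v = v.
Proof. by apply: val_inj; rewrite /= reduce_id ?fp_wordP. Qed.

Lemma fp_of_word_cat s t :
  fp_of_word (s ++ t) = fp_mul (fp_of_word s) (fp_of_word t).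
Proof.
apply: fp_word_inj; rewrite fp_mulE /= /reduce foldr_cat.
by rewrite foldr_push_foldr // reduce_reduced.
Qed.

Lemma fp_mulA : associative fp_mul.
Proof.
move=> u v w; apply: fp_word_inj.
by rewrite !fp_mulE foldr_push_foldr ?fp_wordP.
Qed.

Lemma fp_mul1g : left_id fp_one fp_mul.
Proof. by move=> v; rewrite -[RHS]fp_of_wordK. Qed.

Lemma fp_mulg1 : right_id fp_one fp_mul.
Proof. by move=> v; rewrite -[RHS]fp_of_wordK /fp_mul cats0. Qed.

Lemma linvK : involutive (@linv G).
Proof. by case=> [b|h]; rewrite /= ?negbK ?invgK. Qed.

Lemma reduce_invl s : reduce (rev (map (@linv G) s) ++ s) = [::].
Proof.
elim: s => //= l s IHs; rewrite rev_cons cat_rcons /reduce foldr_cat /=.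
by rewrite pushK -?foldr_cat ?IHs //; exact: reduce_reduced.
Qed.

Lemma fp_mulVg : left_inverse fp_one fp_inv fp_mul.
Proof.
move=> v; rewrite -{2}[v]fp_of_wordK -fp_of_word_cat.
by apply: val_inj; rewrite /= reduce_invl.
Qed.

Lemma fp_mulgV : right_inverse fp_one fp_inv fp_mul.
Proof.
move=> v; rewrite -{1}[v]fp_of_wordK -fp_of_word_cat.
apply: val_inj => /=; have := reduce_invl (rev (map (@linv G) v)).
by rewrite map_rev revK (mapK linvK).
Qed.

HB.instance Definition _ := isGroup.Build (free_prod G)
  fp_mulA fp_mul1g fp_mulg1 fp_mulVg fp_mulgV.

Lemma fp_of_wordM s t : fp_of_word (s ++ t) = fp_of_word s * fp_of_word t.
Proof. exact: fp_of_word_cat. Qed.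

(** ** The evaluation homomorphism [x |-> g] *)

Definition eval_letter (g : G) (l : letter G) : G :=
  match l with
  | inl b => if b then g^-1 else g
  | inr h => h
  end.

Definition phi (g : G) (w : free_prod G) : G :=
  \prod_(l <- w) eval_letter g l.

Lemma prod_push g l s :
  \prod_(k <- push l s) eval_letter g k =
  eval_letter g l * \prod_(k <- s) eval_letter g k.
Proof.
case: l s => [b|h] [|[c|k] s] /=; rewrite ?big_cons //=.
- by case: eqP => [->|]; rewrite ?big_cons //=; case: b c => [] [] //= _;
    rewrite ?mulKg ?mulVKg.
- by case: eqP => [->|_]; rewrite ?mul1g // big_cons.
- by case: eqP => [->|_]; rewrite ?mul1g // !big_cons.
- by rewrite mulgA; case: eqP => [->|_]; rewrite ?mul1g // big_cons.
Qed.

Lemma phi_of_word g s :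
  phi g (fp_of_word s) = \prod_(l <- s) eval_letter g l.
Proof.
rewrite /phi /=; elim: s => [|l s IHs]; first by rewrite !big_nil.
by rewrite /= prod_push IHs big_cons.
Qed.

Lemma phi_morph g : {morph phi g : v w / v * w}.
Proof. by move=> v w; rewrite phi_of_word big_cat. Qed.

HB.instance Definition _ g :=
  isMultiplicative.Build (free_prod G) G (phi g) (phi_morph g).

Lemma phi_x g : phi g (fp_of_word [:: inl false]) = g.
Proof. by rewrite phi_of_word big_seq1. Qed.

Lemma phi_coef g h : phi g (fp_of_word [:: inr h]) = h.
Proof. by rewrite phi_of_word big_seq1. Qed.

(** ** Equations with coefficients in a subgroup *)

(** For a subgroup [H] of [G], the free product of [H] and the infinite cyclic
    group on [x] is the subgroup of [free_prod G] formed by the reduced words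
    all of whose coefficients lie in [H]. *)
Definition equation_over (H : G -> Prop) (w : free_prod G) : Prop :=
  forall h, (inr h : letter G) \in fp_word w -> H h.

Lemma equation_over_fp_of_word (H : G -> Prop) s :
  (forall h k, H h -> H k -> H (h * k)) ->
  (forall h, (inr h : letter G) \in s -> H h) -> equation_over H (fp_of_word s).
Proof.
move=> HM; rewrite /equation_over /=; elim: s => //= l s IHs Hs.
have /IHs {IHs} : forall h, (inr h : letter G) \in s -> H h.
  by move=> h hs; apply: Hs; rewrite inE hs orbT.
move: (reduce s) => t Ht; case: l t Hs Ht => [b|h] [|[c|k] t] Hs Ht j /=.
- by [].
- case: ifP => _ jt; last by apply: Ht; rewrite inE jt orbT.
  by apply: Ht; move: jt; rewrite !inE.
- by rewrite !inE => jt; apply: Ht; rewrite inE; case/or3P: jt => // ->;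
    rewrite ?orbT.
- by case: ifP => // _; rewrite inE => /eqP[->]; apply: Hs; rewrite inE eqxx.
- case: ifP => _ jt; first exact: Ht.
  move: jt; rewrite inE => /orP[/eqP[->]|]; last exact: Ht.
  by apply: Hs; rewrite inE eqxx.
- case: ifP => _ jt; first by apply: Ht; rewrite inE jt orbT.
  move: jt; rewrite inE => /orP[/eqP[->]|jt]; last first.
    by apply: Ht; rewrite inE jt orbT.
  by apply: HM; [apply: Hs|apply: Ht]; rewrite inE eqxx.
Qed.

Lemma equation_overM (H : G -> Prop) v w :
  (forall h k, H h -> H k -> H (h * k)) ->
  equation_over H v -> equation_over H w -> equation_over H (v * w).
Proof.
move=> HM Hv Hw; apply: equation_over_fp_of_word => // h.
by rewrite mem_cat => /orP[/Hv|/Hw].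
Qed.

Lemma equation_overV (H : G -> Prop) w :
  (forall h k, H h -> H k -> H (h * k)) -> (forall h, H h -> H h^-1) ->
  equation_over H w -> equation_over H w^-1.
Proof.
move=> HM HV Hw; apply: equation_over_fp_of_word => // h.
by rewrite mem_rev => /mapP[[b|k] kw] //= [->]; apply/HV/Hw.
Qed.

Definition eqn_ideal (H : G -> Prop) (g : G) (w : free_prod G) : Prop :=
  equation_over H w /\ phi g w = 1.

Definition depends_on (H : G -> Prop) (g : G) : Prop :=
  exists w, eqn_ideal H g w /\ w <> 1.

(** ** Cyclic reduction and degree *)

(** One step compares the first and the last letter of a word with at least
    two letters: opposite occurrences of [x] are deleted, and two coefficients
    are merged into one, or deleted if their product is trivial. *)
Definition cyclic_step s : word G :=
  if s is l :: (_ :: _) as t then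
    let m := take (size t).-1 t in
    match l, last l t with
    | inl b, inl c => if b == c then s else m
    | inr h, inr k => if k * h == 1 then m else rcons m (inr (k * h))
    | _, _ => s
    end
  else s.

Definition cyclic_reduction s : word G := iter (size s) cyclic_step s.

Definition cyclically_reduced s :=
  reduced s && (if s is l :: (_ :: _) as t then may_follow (last l t) l
                else true).

Lemma cyclic_step_rcons (l z : letter G) s :
  cyclic_step (l :: rcons s z) =
  match l, z with
  | inl b, inl c => if b == c then l :: rcons s z else s
  | inr h, inr k => if k * h == 1 then s else rcons s (inr (k * h))
  | _, _ => l :: rcons s z
  end.
Proof.
have take_s : take (size (rcons s z)).-1 (rcons s z) = s.
  by rewrite size_rcons -cats1 take_size_cat.
by case: l => ?; rewrite /cyclic_step last_rcons take_s; case: s {take_s}.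
Qed.

Lemma cyclic_step_reduced s : reduced s -> reduced (cyclic_step s).
Proof.
case: s => [|l t] //; case/lastP: t => [|s z] //; rewrite cyclic_step_rcons.
move=> rs; have /andP[] := reduced_cons rs; rewrite all_rcons => /andP[pz ps] ss.
have rs' : reduced s.
  apply/andP; split=> //; case: s ss {rs ps} => //= k s.
  by rewrite rcons_path => /andP[].
case: l z {pz} ss rs => [b|h] [c|k] ss rs //; case: ifP => // /negbT kh1.
rewrite /reduced all_rcons /= kh1 ps /=.
by case: s ss {ps rs rs'} => //= j s; rewrite !rcons_path; case: (last _ _).
Qed.

Lemma cyclic_step_size s : cyclic_step s != s -> size (cyclic_step s) < size s.
Proof.
case: s => [|l t]; first by rewrite eqxx.
case/lastP: t => [|s z]; first by rewrite eqxx.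
rewrite cyclic_step_rcons; case: l z => [b|h] [c|k]; rewrite ?eqxx //=;
  by case: ifP; rewrite ?eqxx ?size_rcons // => _ _; rewrite ltnW.
Qed.

Lemma cyclic_step_fixed s :
  reduced s -> cyclic_step s = s -> cyclically_reduced s.
Proof.
move=> rs; rewrite /cyclically_reduced rs; case: s {rs} => [|l t] //.
case/lastP: t => [|s z] //; rewrite cyclic_step_rcons.
have size_neq t : size t < (size s).+2 -> t = l :: rcons s z -> false.
  by move=> lt e; move: lt; rewrite e /= size_rcons ltnn.
have -> b : (if rcons s z is _ :: _ then b else true) = b by case: s {size_neq}.
rewrite last_rcons; case: l z size_neq => [b|h] [c|k] size_neq //=.
  by case: (eqVneq b c) => [->|_]; rewrite ?eqxx // => /size_neq->.
by case: ifP => _ /size_neq->; rewrite ?size_rcons.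
Qed.

Lemma cyclic_reductionP s :
  reduced s -> cyclically_reduced (cyclic_reduction s).
Proof.
suff gen m : size s <= m -> reduced s ->
    cyclically_reduced (iter m cyclic_step s) by exact: gen.
elim: m s => [|m IHm] s; first by rewrite leqn0 size_eq0 => /eqP->.
move=> sm rs; rewrite iterSr; have rs' := cyclic_step_reduced rs.
have [e|/cyclic_step_size lt] := eqVneq (cyclic_step s) s.
  by rewrite e iter_fix //; apply: cyclic_step_fixed.
by apply: IHm rs'; rewrite -ltnS; apply: leq_trans sm.
Qed.

Lemma cyclic_step_conj s :
  exists v, fp_of_word (cyclic_step s) = fp_of_word s ^ v.
Proof.
case: s => [|l t]; first by exists 1; rewrite conjg1.
case/lastP: t => [|s z]; first by exists 1; rewrite conjg1.
rewrite cyclic_step_rcons.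
have E : fp_of_word (l :: rcons s z) ^ fp_of_word [:: l] =
    fp_of_word s * (fp_of_word [:: z] * fp_of_word [:: l]).
  by rewrite -cat1s -cats1 !fp_of_wordM conjgE !mulgA mulVg mul1g.
have W (a b : letter G) : fp_of_word [:: a] * fp_of_word [:: b] =
  fp_of_word [:: a; b] by rewrite -fp_of_wordM.
case: l z E => [b|h] [c|k] E; try by exists 1; rewrite conjg1.
- case: (eqVneq b c) => [_|bc]; first by exists 1; rewrite conjg1.
  exists (fp_of_word [:: inl b]); rewrite E W.
  rewrite -[LHS]mulg1; congr (_ * _); apply: fp_word_inj.
  by rewrite /= /reduce /=; case: b c bc {E} => [] [].
- exists (fp_of_word [:: inr h]); rewrite E W.
  have -> : fp_of_word [:: inr k; inr h] = fp_of_word [:: inr (k * h)].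
    by apply: fp_word_inj; exact: push_coef.
  case: eqP => [->|_]; last by rewrite -cats1 fp_of_wordM.
  rewrite -[LHS]mulg1; congr (_ * _); apply: fp_word_inj.
  by rewrite /= /reduce /= eqxx.
Qed.

Lemma cyclic_reduction_conj s :
  exists v, fp_of_word (cyclic_reduction s) = fp_of_word s ^ v.
Proof.
rewrite /cyclic_reduction; elim: (size s) => [|m [v IHm]].
  by exists 1; rewrite conjg1.
have [u Hu] := cyclic_step_conj (iter m cyclic_step s).
by exists (v * u); rewrite iterS Hu IHm conjgM.
Qed.

Definition is_x (l : letter G) := if l is inl _ then true else false.

(** The number of occurrences of [x] does not depend on the end at which
    [cyclic_step] puts a merged coefficient. *)
Definition degree (w : free_prod G) : nat :=
  count is_x (cyclic_reduction w).

End FreeProductTheory.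

(** * Algorithms *)

(** The model of computation is a variable-free form of Jones's language WHILE
    (Computability and Complexity from a Programming Perspective, 1997): the
    data are binary trees and a program transforms a single tree.  Its programs
    compute exactly the partial recursive functions on trees. *)
Inductive tree := Leaf | Node of tree & tree.

Definition hd t := if t is Node a _ then a else Leaf.
Definition tl t := if t is Node _ b then b else Leaf.

Inductive prog :=
| PId
| PLeaf
| PHd
| PTl
| PNode of prog & prog
| PSeq of prog & prog
| PIf of prog & prog & prog
| PWhile of prog & prog.

(** [runs p t r]: the program [p] halts on input [t] with output [r].  A test
    succeeds if its value is not [Leaf]. *)
Inductive runs : prog -> tree -> tree -> Prop :=
| RId t : runs PId t t
| RLeaf t : runs PLeaf t Leaf
| RHd t : runs PHd t (hd t)
| RTl t : runs PTl t (tl t)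
| RNode p q t a b :
    runs p t a -> runs q t b -> runs (PNode p q) t (Node a b)
| RSeq p q t a b :
    runs p t a -> runs q a b -> runs (PSeq p q) t b
| RIfTrue c p q t a b r :
    runs c t (Node a b) -> runs p t r -> runs (PIf c p q) t r
| RIfFalse c p q t r :
    runs c t Leaf -> runs q t r -> runs (PIf c p q) t r
| RWhileStop c p t :
    runs c t Leaf -> runs (PWhile c p) t t
| RWhileLoop c p t a b t' r :
    runs c t (Node a b) -> runs p t t' -> runs (PWhile c p) t' r ->
    runs (PWhile c p) t r.

Lemma runs_functional p t r1 r2 : runs p t r1 -> runs p t r2 -> r1 = r2.
Proof.
move=> run1; elim: run1 r2 => {p t r1}.
- by move=> t r2 H; inversion H.
- by move=> t r2 H; inversion H.
- by move=> t r2 H; inversion H.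
- by move=> t r2 H; inversion H.
- move=> p q t a b _ IHp _ IHq r2 H; inversion H; subst.
  by rewrite (IHp a0) // (IHq b0).
- move=> p q t a b _ IHp _ IHq r2 H; inversion H; subst.
  by apply: IHq; rewrite (IHp a0).
- move=> c p q t a b r _ IHc _ IHp r2 H; inversion H; subst; first exact: IHp.
  by have := IHc _ H5.
- move=> c p q t r _ IHc _ IHq r2 H; inversion H; subst; last exact: IHq.
  by have := IHc _ H5.
- move=> c p t _ IHc r2 H; inversion H; subst => //.
  by have := IHc _ H2.
- move=> c p t a b t' r _ IHc _ IHp _ IHw r2 H; inversion H; subst.
    by have := IHc _ H4.
  by apply: IHw; rewrite (IHp t'0).
Qed.

Definition enc_nat (m : nat) : tree := iter m (Node Leaf) Leaf.
Definition enc_bool (b : bool) : tree := if b then Node Leaf Leaf else Leaf.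
Definition enc_seq (T : Type) (enc : T -> tree) (s : seq T) : tree :=
  foldr (fun a t => Node (enc a) t) Leaf s.

Section Encoding.
Variable n : nat.

Definition enc_fletter (l : fletter n) : tree :=
  Node (enc_nat l.1) (enc_bool l.2).

Definition enc_fword : fword n -> tree := enc_seq enc_fletter.

Definition enc_letter (l : letter (free_group n)) : tree :=
  match l with
  | inl b => Node (enc_bool false) (enc_bool b)
  | inr h => Node (enc_bool true) (enc_fword h)
  end.

Definition enc_equation (w : free_prod (free_group n)) : tree :=
  enc_seq enc_letter w.

(** The generators of [H] and the element [g] are given by words in the basis,
    which need not be reduced. *)
Definition enc_input (S : seq (fword n)) (u : fword n) : tree :=
  Node (enc_seq enc_fword S) (enc_fword u).

End Encoding.

(* Main.v *)
From HB Require Import structures.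
From Stdlib Require Import Classical.
From mathcomp Require Import all_boot zify.
Require Import Defs.

Set Implicit Arguments.
Unset Strict Implicit.
Unset Printing Implicit Defensive.

(** An equation of minimal degree may be taken cyclically reduced, so one has to
    minimise the number of occurrences of [x] over the nonempty reduced words of
    [H * <x>] that evaluate to 1.  The algorithm searches through all trees for
    a word in [x] and the generators of [H] that evaluates to 1, together with a
    finite certificate that fewer occurrences of [x] are impossible.

    The certificate is in the style of Benois.  It has an inverse automaton [D] in
    which the generators of [H] are loops at the base vertex; then so are the
    reduced words of all elements of [H].  It also has a finite set [Q] of states
    of the machine that guesses a reduced word of [H * <x>] with a bounded
    number of occurrences of [x] while spelling out its value letter by letter,
    and a set [N] of pairs of states that is reflexive, transitive and closed
    under cancellation of [a a^-1] around a pair.  So [N] contains all pairs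
    joined by a path that spells 1, and it suffices that [N] joins the initial
    state to no final one.

    If the number of occurrences of [x] is minimal, such a certificate exists:
    take for [D] the coset graph of [H] restricted to the cosets of prefixes of
    generators, and for [N] the least relation with these closure properties. *)

(** * Computable functions on trees *)

Fixpoint tree_eqb (s t : tree) : bool :=
  match s, t with
  | Leaf, Leaf => true
  | Node a b, Node c d => tree_eqb a c && tree_eqb b d
  | _, _ => false
  end.

Lemma tree_eqP : Equality.axiom tree_eqb.
Proof.
elim=> [|a IHa b IHb] [|c d] /=; try by constructor.
by apply: (iffP andP) => [[/IHa-> /IHb->]|[<- <-]] //; split; [apply/IHa|apply/IHb].
Qed.

HB.instance Definition _ := hasDecEq.Build tree tree_eqP.

Definition isnode (t : tree) : bool := if t is Node _ _ then true else false.

Fixpoint tlist (t : tree) : seq tree :=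
  if t is Node a b then a :: tlist b else [::].

Definition olist (s : seq tree) : tree := foldr Node Leaf s.

Lemma olistK : cancel olist tlist.
Proof. by elim=> //= a s ->. Qed.

Lemma tlistK : cancel tlist olist.
Proof. by elim=> //= a _ b ->. Qed.

Definition computable (f : tree -> tree) := exists p, forall t, runs p t (f t).
Definition computable_pred (f : tree -> bool) := computable (fun t => enc_bool (f t)).
Definition computable_list (f : tree -> seq tree) := computable (fun t => olist (f t)).

Lemma comp_ext f g : f =1 g -> computable f -> computable g.
Proof. by move=> fg [p Hp]; exists p => t; rewrite -fg. Qed.

Lemma comp_id : computable (fun t => t).
Proof. by exists PId => t; constructor. Qed.

Lemma comp_const c : computable (fun _ => c).
Proof.
elim: c => [|a [p Hp] b [q Hq]]; first by exists PLeaf => t; constructor.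
by exists (PNode p q) => t; constructor.
Qed.

Lemma comp_comp f g : computable f -> computable g -> computable (fun t => f (g t)).
Proof. by move=> [p Hp] [q Hq]; exists (PSeq q p) => t; econstructor. Qed.

Lemma comp_hd f : computable f -> computable (fun t => hd (f t)).
Proof. by apply: comp_comp; exists PHd => t; constructor. Qed.

Lemma comp_tl f : computable f -> computable (fun t => tl (f t)).
Proof. by apply: comp_comp; exists PTl => t; constructor. Qed.

Lemma comp_node f g : computable f -> computable g -> computable (fun t => Node (f t) (g t)).
Proof. by move=> [p Hp] [q Hq]; exists (PNode p q) => t; constructor. Qed.

Lemma comp_ifnode c f g : computable c -> computable f -> computable g ->
  computable (fun t => if isnode (c t) then f t else g t).
Proof.
move=> [r Hr] [p Hp] [q Hq]; exists (PIf r p q) => t.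
case E: (c t) (Hr t) => [|a b] Hc /=; first exact: RIfFalse.
exact: RIfTrue Hc _.
Qed.

Lemma comp_if b f g : computable_pred b -> computable f -> computable g ->
  computable (fun t => if b t then f t else g t).
Proof.
move=> cb cf cg; apply: comp_ext (comp_ifnode cb cf cg) => t.
by case: (b t).
Qed.

Lemma comp_while c f F (m : tree -> nat) : computable c -> computable f ->
  (forall t, F t = if isnode (c t) then F (f t) else t) ->
  (forall t, isnode (c t) -> m (f t) < m t) -> computable F.
Proof.
move=> [q Hq] [p Hp] FE Fm; exists (PWhile q p) => t.
have [k] := ubnP (m t); elim: k t => // k IHk t; rewrite ltnS => mt.
rewrite FE; case E: (c t) (Hq t) => [|a b] Hc /=; first exact: RWhileStop.
apply: RWhileLoop Hc (Hp t) (IHk _ _).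
by apply: leq_trans mt; apply: Fm; rewrite E.
Qed.

Lemma compb_isnode f : computable f -> computable_pred (fun t => isnode (f t)).
Proof.
move=> cf; apply: comp_ext (comp_ifnode cf (comp_const (Node Leaf Leaf)) (comp_const Leaf)).
by move=> t; case: (f t).
Qed.

Lemma compb_const b : computable_pred (fun _ => b).
Proof. exact: comp_const. Qed.

Lemma compb_if b f g : computable_pred b -> computable_pred f -> computable_pred g ->
  computable_pred (fun t => if b t then f t else g t).
Proof.
move=> cb cf cg; apply: comp_ext (comp_if cb cf cg) => t.
by case: (b t).
Qed.

Lemma compb_ext f g : f =1 g -> computable_pred f -> computable_pred g.
Proof. by move=> fg; apply: comp_ext => t; rewrite fg. Qed.

Lemma compb_and f g : computable_pred f -> computable_pred g -> computable_pred (fun t => f t && g t).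
Proof. by move=> cf cg; apply: (compb_if cf cg (compb_const false)). Qed.

Lemma compb_or f g : computable_pred f -> computable_pred g -> computable_pred (fun t => f t || g t).
Proof. by move=> cf cg; apply: (compb_if cf (compb_const true) cg). Qed.

Lemma compb_not f : computable_pred f -> computable_pred (fun t => ~~ f t).
Proof. by move=> cf; apply: (compb_if cf (compb_const false) (compb_const true)). Qed.

Lemma compb_imply f g : computable_pred f -> computable_pred g -> computable_pred (fun t => f t ==> g t).
Proof. by move=> cf cg; apply: (compb_if cf cg (compb_const true)). Qed.

Lemma lcomp_tlist f : computable f -> computable_list (fun t => tlist (f t)).
Proof. by apply: comp_ext => t; rewrite tlistK. Qed.

Lemma comp_olist f : computable_list f -> computable (fun t => olist (f t)).
Proof. by []. Qed.

Lemma comp_enc_bool f : computable_pred f -> computable (fun t => enc_bool (f t)).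
Proof. by []. Qed.

Lemma lcomp_nil : computable_list (fun _ => [::]).
Proof. exact: comp_const. Qed.

Lemma lcomp_cons f g : computable f -> computable_list g -> computable_list (fun t => f t :: g t).
Proof. exact: comp_node. Qed.

Lemma lcomp_if b f g : computable_pred b -> computable_list f -> computable_list g ->
  computable_list (fun t => if b t then f t else g t).
Proof.
move=> cb cf cg; apply: comp_ext (comp_if cb cf cg) => t.
by case: (b t).
Qed.

(** [computability_user] is redefined below whenever closure lemmas for further
    operations have become available to [computability]. *)
Ltac computability_user := fail.

Ltac computability_step := cbv beta zeta; first
  [ assumption
  | simple apply comp_const | simple apply compb_const | simple apply lcomp_nil
  | simple apply comp_id
  | simple apply comp_hd | simple apply comp_tl | simple apply comp_node
  | simple apply comp_if | simple apply compb_if | simple apply lcomp_if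
  | simple apply compb_isnode | simple apply compb_and | simple apply compb_or
  | simple apply compb_not | simple apply compb_imply
  | simple apply lcomp_tlist | simple apply lcomp_cons
  | simple apply comp_olist | simple apply comp_enc_bool
  | computability_user
  | match goal with
    | H : computable ?a |- computable (fun z => ?a (@?f z)) =>
        simple apply (comp_comp (f := a) (g := f) H)
    end ].

Ltac computability := solve [repeat computability_step].

(** A function of several arguments is said to be computable if it is so after
    packing the arguments into one tree.  The first argument of [f] is the
    context, which lets the body of the fold mention [t]. *)
Lemma comp_foldl f i l :
  computable (fun z => f (hd z) (hd (tl z)) (tl (tl z))) -> computable i -> computable_list l ->
  computable (fun t => foldl (f t) (i t) (l t)).
Proof.
move=> cf ci cl.
pose step z := Node (hd z) (Node (f (hd z) (hd (tl z)) (hd (tl (tl z)))) (tl (tl (tl z)))).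
pose F z := if isnode (tl (tl z)) then
  Node (hd z) (Node (foldl (f (hd z)) (hd (tl z)) (tlist (tl (tl z)))) Leaf) else z.
have cstep : computable step.
  apply: comp_node; [computability|apply: comp_node; [|computability]].
  apply: (comp_comp (g := fun z => Node (hd z) (Node (hd (tl z)) (hd (tl (tl z))))) cf).
  computability.
have cF : computable F.
  apply: (@comp_while (fun z => tl (tl z)) step F (fun z => size (tlist (tl (tl z))))) => //.
  - computability.
  - by case=> [|t [|a [|x l']]] //; rewrite /F /step /=; case: l'.
  - by case=> [|t [|a [|x l']]] //.
apply: comp_ext (comp_hd (comp_tl (comp_comp cF (comp_node comp_id (comp_node ci cl))))).
by move=> t; rewrite /F /= olistK; case: (l t).
Qed.

Lemma lcomp_rev l : computable_list l -> computable_list (fun t => rev (l t)).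
Proof.
move=> cl.
have cf : computable (fun t => foldl (fun acc x => Node x acc) Leaf (l t)).
  by apply: comp_foldl; computability.
apply: comp_ext cf => t; rewrite -[l t]revK foldl_rev revK.
by rewrite /olist; elim: (rev _) => //= x s ->.
Qed.

Lemma comp_foldr f i l :
  computable (fun z => f (hd z) (hd (tl z)) (tl (tl z))) -> computable i -> computable_list l ->
  computable (fun t => foldr (f t) (i t) (l t)).
Proof.
move=> cf ci cl.
have cg : computable (fun t => foldl (fun acc x => f t x acc) (i t) (rev (l t))).
  apply: comp_foldl (lcomp_rev cl) => //.
  apply: (comp_comp (g := fun z => Node (hd z) (Node (tl (tl z)) (hd (tl z)))) cf).
  by computability.
by apply: comp_ext cg => t; rewrite foldl_rev.
Qed.

Lemma lcomp_map f l : computable (fun z => f (hd z) (tl z)) -> computable_list l ->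
  computable_list (fun t => map (f t) (l t)).
Proof.
move=> cf cl.
have cg : computable (fun t => foldr (fun x acc => Node (f t x) acc) Leaf (l t)).
  apply: comp_foldr => //; last by computability.
  apply: comp_node; last by computability.
  apply: (comp_comp (g := fun z => Node (hd z) (hd (tl z))) cf).
  by computability.
by apply: comp_ext cg => t; elim: (l t) => //= x s ->.
Qed.

Lemma lcomp_filter P l : computable_pred (fun z => P (hd z) (tl z)) -> computable_list l ->
  computable_list (fun t => filter (P t) (l t)).
Proof.
move=> cf cl.
have cg : computable (fun t => foldr (fun x acc => if P t x then Node x acc else acc) Leaf (l t)).
  apply: comp_foldr => //; last by computability.
  apply: comp_if; try by computability.
  apply: (comp_comp (g := fun z => Node (hd z) (hd (tl z))) cf).
  by computability.
by apply: comp_ext cg => t; elim: (l t) => //= x s ->; case: ifP.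
Qed.

Lemma compb_all P l : computable_pred (fun z => P (hd z) (tl z)) -> computable_list l ->
  computable_pred (fun t => all (P t) (l t)).
Proof.
move=> cf cl.
have cg : computable (fun t => foldr (fun x acc => if P t x then acc else Leaf) (enc_bool true) (l t)).
  apply: comp_foldr => //; last by computability.
  apply: comp_if; try by computability.
  apply: (comp_comp (g := fun z => Node (hd z) (hd (tl z))) cf).
  by computability.
by apply: comp_ext cg => t; elim: (l t) => //= x s ->; case: ifP.
Qed.

Lemma compb_has P l : computable_pred (fun z => P (hd z) (tl z)) -> computable_list l ->
  computable_pred (fun t => has (P t) (l t)).
Proof.
move=> cP cl.
have c : computable_pred (fun t => ~~ all (fun x => ~~ P t x) (l t)).
  by apply/compb_not/compb_all => //; apply: compb_not.
by apply: compb_ext c => t; rewrite -has_predC; apply: eq_has => x /=; rewrite negbK.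
Qed.

Lemma lcomp_cat k l : computable_list k -> computable_list l -> computable_list (fun t => k t ++ l t).
Proof.
move=> ck cl.
have c : computable (fun t => foldr (fun x acc => Node x acc) (olist (l t)) (k t)).
  by apply: comp_foldr; computability.
by apply: comp_ext c => t; elim: (k t) => //= x s ->.
Qed.

Section TreeEquality.

Let pending z := tlist (tl z).

Let step z :=
  let e := hd (tl z) in let r := tl (tl z) in
  if isnode (hd e) && isnode (tl e) then
    Node (hd z) (Node (Node (hd (hd e)) (hd (tl e)))
                      (Node (Node (tl (hd e)) (tl (tl e))) r))
  else if isnode (hd e) || isnode (tl e) then Node Leaf Leaf
  else Node (hd z) r.

Let result z :=
  if isnode (tl z) then
    if all (fun e => hd e == tl e) (pending z) then Node (hd z) Leaf
    else Node Leaf Leaf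
  else z.

Let Fixpoint tsize t := if t is Node a b then (tsize a + tsize b).+1 else 1.


Lemma compb_eq f g : computable f -> computable g -> computable_pred (fun t => f t == g t).
Proof.
move=> cf cg.
have cstep : computable step.
  by rewrite /step; computability.
have cres : computable result.
  apply: (@comp_while tl step _ (fun z => sumn (map tsize (pending z)))) => //.
  - exact: comp_tl comp_id.
  - case=> [|ok [|e r]] //=; rewrite /result /step /pending /=.
    case: e => [|[|a b] [|c d]] //=; try by case: r => // [|? ?]; rewrite ?eqxx.
    rewrite (_ : (Node a b == Node c d) = (a == c) && (b == d)) // andbA.
    by [].
  - case=> [|ok [|e r]] //= _; rewrite /step /pending /=.
    case: e => [|[|a b] [|c d]] //=; rewrite ?addSn ?ltnS ?leq_addl //; lia.

have c := compb_isnode (comp_hd (comp_comp cres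
  (comp_node (comp_const (Node Leaf Leaf))
    (comp_node (comp_node cf cg) (comp_const Leaf))))).
apply: compb_ext c => t; rewrite /result /pending /= andbT.
by case: eqP.
Qed.

End TreeEquality.

Ltac computability_user ::= first
  [ simple apply compb_eq | simple apply lcomp_rev | simple apply lcomp_cat
  | simple apply comp_foldl | simple apply comp_foldr
  | simple apply lcomp_map | simple apply lcomp_filter
  | simple apply compb_all | simple apply compb_has ].

Lemma compb_mem f l : computable f -> computable_list l -> computable_pred (fun t => f t \in l t).
Proof.
move=> cf cl.
have c : computable_pred (fun t => has (fun x => f t == x) (l t)).
  apply: compb_has => //; apply: compb_eq; last by computability.
  by apply: (comp_comp cf); computability.
apply: compb_ext c => t; rewrite -has_pred1; apply: eq_has => x.
by rewrite /= eq_sym.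
Qed.


Definition next_trees T : tree :=
  foldr (fun a acc => foldr (fun b acc => Node (Node a b) acc) acc (tlist T))
    (Node Leaf Leaf) (tlist T).

Lemma comp_next_trees : computable next_trees.
Proof. rewrite /next_trees. computability. Qed.

Lemma mem_next_trees T t :
  (t \in tlist (next_trees T)) =
  (if t is Node a b then (a \in tlist T) && (b \in tlist T) else true).
Proof.
rewrite /next_trees; set r := {2 3}(tlist T); move: (tlist T) @r => s r.
have inner a acc : tlist (foldr (fun b acc => Node (Node a b) acc) acc s) =
    map (Node a) s ++ tlist acc by elim: s {r} => //= b s ->.
elim: r => [|c r IHr] /=; first by case: t.
rewrite inner mem_cat {}IHr; case: t => [|a b]; first by rewrite orbT.
rewrite inE; case: (eqVneq a c) => [->|ac] /=.
  rewrite mem_map; last by move=> ? ? [].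
  by case: (b \in s); rewrite ?andbF.
case: mapP => // -[d _ [ac' _]]; by rewrite ac' eqxx in ac.
Qed.

Fixpoint depth t := if t is Node a b then (maxn (depth a) (depth b)).+1 else 0.

Lemma mem_iter_next_trees k t : (t \in tlist (iter k.+1 next_trees Leaf)) = (depth t <= k).
Proof.
elim: k t => [|k IHk] t; rewrite iterS mem_next_trees; first by case: t.
by case: t => //= a b; rewrite !IHk ltnS geq_max.
Qed.

Lemma runs_while_until c b (C : tree -> bool) (B : tree -> tree) t m :
  (forall t, runs c t (enc_bool (~~ C t))) -> (forall t, runs b t (B t)) ->
  C (iter m B t) -> exists2 k, runs (PWhile c b) t (iter k B t) & C (iter k B t).
Proof.
move=> Hc Hb; elim: m t => [|m IHm] t Ct.
  by exists 0 => //; have := Hc t; rewrite Ct; apply: RWhileStop.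
have := Hc t; case E: (C t) => /= run_c.
  by exists 0 => //; apply: RWhileStop.
have [|k run Ck] := IHm (B t); first by rewrite -iterSr.
by exists k.+1; rewrite iterSr //; apply: RWhileLoop run_c (Hb t) run.
Qed.

Lemma unbounded_search (check : tree -> tree -> bool) (output : tree -> tree) :
  computable_pred (fun z => check (hd z) (tl z)) -> computable output ->
  exists p, forall inp, (exists t, check inp t) ->
    exists2 t, check inp t & runs p inp (output t).
Proof.
move=> ccheck cout.
have [q Hq] : computable_pred (fun z => ~~ has (check (hd z)) (tlist (tl z))).
  apply: compb_not; apply: compb_has; last by computability.
  apply: (comp_comp (g := fun z => Node (hd (hd z)) (tl z)) ccheck).
  by computability.
have [b Hb] : computable (fun z => Node (hd z) (next_trees (tl z))).
  by apply: comp_node (comp_comp comp_next_trees _); computability.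
have [i Hi] : computable (fun t => Node t Leaf) by computability.
have [f Hf] : computable (fun z => output (foldl (fun acc t =>
    if check (hd z) t then t else acc) Leaf (tlist (tl z)))).
  apply: comp_comp cout _; apply: comp_foldl; try computability.
  apply: comp_if; try computability.
  apply: (comp_comp (g := fun z => Node (hd (hd z)) (tl (tl z))) ccheck).
  computability.
exists (PSeq i (PSeq (PWhile q b) f)) => inp [t0 Ht0].
have iterE k T : iter k (fun z => Node (hd z) (next_trees (tl z))) (Node inp T) =
    Node inp (iter k next_trees T) by elim: k => //= k ->.
have [|k] := runs_while_until (t := Node inp Leaf) (m := (depth t0).+1) Hq Hb.
  by rewrite iterE /=; apply/hasP; exists t0; rewrite ?mem_iter_next_trees.
rewrite iterE /= => run has_k.
exists (foldl (fun acc t => if check inp t then t else acc) Leaf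
    (tlist (iter k next_trees Leaf))); last exact: RSeq (Hi _) (RSeq run (Hf _)).
move: (tlist _) has_k => s {run}; move: Leaf => a; elim: s a => //= t s IHs a.
case: (boolP (has (check inp) s)) => [has_s _|]; first exact: IHs.
move=> /hasPn ns; rewrite orbF => Ht; rewrite Ht.
elim: s t Ht ns {IHs a} => //= x s IHs t Ht ns.
rewrite (negPf (ns x _)) ?mem_head //.
by apply: IHs => // y ys; apply: ns; rewrite inE ys orbT.
Qed.

(** * The certificate checker *)

Definition tinv l := Node (hd l) (enc_bool (~~ isnode (tl l))).
Definition tfpush l s :=
  if isnode s && (hd s == tinv l) then tl s else Node l s.
Definition tmul s t := foldr tfpush t (tlist s).
Definition twinv s := olist (rev (map tinv (tlist s))).

Definition tx b := Node Leaf (enc_bool b).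
Definition tcoef h := Node (Node Leaf Leaf) h.

Definition tpush l s :=
  if isnode (hd l) then
    if isnode s && isnode (hd (hd s)) then
      if isnode (tmul (tl l) (tl (hd s))) then
        Node (tcoef (tmul (tl l) (tl (hd s)))) (tl s)
      else tl s
    else if isnode (tl l) then Node l s else s
  else if [&& isnode s, ~~ isnode (hd (hd s)) & hd s != l] then tl s
  else Node l s.
Definition treduce c := foldr tpush Leaf (tlist c).

Definition tpow u e := if isnode (tl e) then twinv u else u.
Definition teval u c := foldr (fun e acc =>
  tmul (if isnode (hd e) then tl e else tpow u e) acc) Leaf (tlist c).
Definition tcount w := foldr (fun e acc =>
  if isnode (hd e) then acc else Node Leaf acc) Leaf (tlist w).

Definition over_gens gens c := all (fun e => [|| e == tx false, e == tx true |
  has (fun s => (e == tcoef (tmul s Leaf)) || (e == tcoef (tmul (twinv s) Leaf)))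
    (tlist gens)]) (tlist c).

Definition base := Node Leaf Leaf.

(** [Leaf] is not a vertex and stands for an undefined transition. *)
Definition dstep (D : seq tree) p a := foldl (fun acc e =>
  if (hd e == p) && (hd (tl e) == a) then tl (tl e) else acc) Leaf D.

Definition drun D p s := foldl (fun q a => dstep D q a) p s.

Definition graph_ok gens D :=
  all (fun e => isnode (hd e) &&
    (dstep D (tl (tl e)) (tinv (hd (tl e))) == hd e)) D &&
  all (fun s => drun D base (tlist s) == base) (tlist gens).

(** The labels for [x] and its inverse, distinct from all values of
    [enc_fletter]. *)
Definition xlet b := Node (Node (Node Leaf Leaf) Leaf) (enc_bool b).

(** In a state, [v] is the word that has been guessed but not yet spelled, [r] the
    number of further occurrences of [x] allowed, [p] the vertex of the automaton
    and [l] the last letter guessed, or [Leaf] if there is none. *)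
Definition state v r p l := Node v (Node r (Node p l)).
Definition pending s := hd s.
Definition budget s := hd (tl s).
Definition vertex s := hd (tl (tl s)).
Definition prior s := tl (tl (tl s)).

Definition succs D u s :=
  [seq state (Node (hd (tl e)) Leaf) (budget s) (tl (tl e)) (hd (tl e)) |
    e <- [seq e <- D | (hd e == vertex s) && (tinv (hd (tl e)) != prior s)]] ++
  (if (vertex s == base) && isnode (budget s) then
     [seq state (tpow u a) (tl (budget s)) base a |
       a <- [seq a <- [:: xlet false; xlet true] | tinv a != prior s]]
   else [::]).

Definition saturated D u (Q N : seq tree) :=
  [&& all (fun s => (Node s s \in N) &&
        if isnode (pending s) then Node (tl (pending s)) (tl s) \in Q
        else all (fun t => (t \in Q) && (Node s t \in N)) (succs D u s)) Q,
      all (fun e => all (fun f =>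
        (tl e == hd f) ==> (Node (hd e) (tl f) \in N)) N) N
    & all (fun s => all (fun e =>
        [&& isnode (pending s), isnode (pending (tl e)),
            Node (tl (pending s)) (tl s) == hd e
          & hd (pending (tl e)) == tinv (hd (pending s))] ==>
        (Node s (Node (tl (pending (tl e))) (tl (tl e))) \in N)) N) Q].

Definition excluded start (Q N : seq tree) :=
  (start \in Q) && all (fun e =>
    [&& hd e == start, ~~ isnode (pending (tl e)) & vertex (tl e) == base] ==>
    (tl e == start)) N.

Definition start w := state Leaf (tl (tcount w)) base Leaf.

(** The input is [Node gens u] and the certificate is
    [Node c (Node D (Node Q N))], where [c] is a word in [x], the generators and
    their inverses, not necessarily reduced. *)
Definition check inp cert :=
  [&& over_gens (hd inp) (hd cert),
      isnode (treduce (hd cert)),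
      ~~ isnode (teval (tl inp) (hd cert)),
      graph_ok (hd inp) (tlist (hd (tl cert))),
      saturated (tlist (hd (tl cert))) (tl inp) (tlist (hd (tl (tl cert)))) (tlist (tl (tl (tl cert))))
    & excluded (start (treduce (hd cert))) (tlist (hd (tl (tl cert)))) (tlist (tl (tl (tl cert))))].

Definition output cert := treduce (hd cert).

Ltac computability_user ::= first
  [ simple apply compb_mem
  | simple apply compb_eq | simple apply lcomp_rev | simple apply lcomp_cat
  | simple apply comp_foldl | simple apply comp_foldr
  | simple apply lcomp_map | simple apply lcomp_filter
  | simple apply compb_all | simple apply compb_has ].

Lemma comp_tmul f g : computable f -> computable g -> computable (fun t => tmul (f t) (g t)).
Proof. by rewrite /tmul /tfpush /tinv => cf cg; computability. Qed.

Lemma comp_twinv f : computable f -> computable (fun t => twinv (f t)).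
Proof. by rewrite /twinv /tinv => cf; computability. Qed.

Lemma comp_treduce f : computable f -> computable (fun t => treduce (f t)).
Proof. rewrite /treduce /tpush /tcoef /tmul /tfpush /tinv => cf.
by computability. Qed.

Ltac computability_user ::= first
  [ simple apply compb_mem | simple apply comp_tmul | simple apply comp_twinv
  | simple apply comp_treduce
  | simple apply compb_eq | simple apply lcomp_rev | simple apply lcomp_cat
  | simple apply comp_foldl | simple apply comp_foldr
  | simple apply lcomp_map | simple apply lcomp_filter
  | simple apply compb_all | simple apply compb_has ].

Lemma comp_output : computable output.
Proof. apply: comp_treduce; computability. Qed.

Lemma comp_check : computable_pred (fun z => check (hd z) (tl z)).
Proof.
rewrite /check /over_gens /graph_ok /drun /dstep /saturated /succs /excluded.
rewrite /start /teval /tcount /tpow /tinv /tx /tcoef /xlet /base.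
rewrite /pending /budget /vertex /prior /state.
by computability.
Qed.

Local Open Scope group_scope.

(** * Encodings of words *)

Lemma enc_nat_inj : injective enc_nat.
Proof. by elim=> [|i IHi] [|j] //= [/IHi->]. Qed.

Lemma enc_bool_inj : injective enc_bool.
Proof. by do 2 case. Qed.

Lemma enc_seq_inj T (enc : T -> tree) : injective enc -> injective (enc_seq enc).
Proof. by move=> inj; elim=> [|a s IHs] [|b t] //= [/inj-> /IHs->]. Qed.

Lemma tlist_enc_seq T (enc : T -> tree) s : tlist (enc_seq enc s) = map enc s.
Proof. by elim: s => //= a s ->. Qed.

Lemma isnode_enc_bool b : isnode (enc_bool b) = b.
Proof. by case: b. Qed.

Lemma isnode_enc_seq T (enc : T -> tree) s :
  isnode (enc_seq enc s) = (0 < size s)%N.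
Proof. by case: s. Qed.

Section Encodings.
Variable n : nat.
Notation G := (free_group n).
Implicit Types (a : fletter n) (s t u : fword n) (c w : word G) (l : letter G).

Lemma enc_fletter_inj : injective (@enc_fletter n).
Proof.
by move=> [i b] [j d] [/enc_nat_inj/val_inj-> /enc_bool_inj->].
Qed.

Lemma enc_fword_inj : injective (@enc_fword n).
Proof. exact/enc_seq_inj/enc_fletter_inj. Qed.

Lemma enc_fletter_eq a (b : fletter n) : (enc_fletter a == enc_fletter b) = (a == b).
Proof. exact/inj_eq/enc_fletter_inj. Qed.

Lemma tinv_fletter a : tinv (enc_fletter a) = enc_fletter (finv a).
Proof. by rewrite /tinv /= isnode_enc_bool. Qed.

Lemma twinv_fword s : twinv (enc_fword s) = enc_fword (rev (map (@finv n) s)).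
Proof.
rewrite /twinv tlist_enc_seq -map_comp -[RHS]tlistK tlist_enc_seq map_rev -map_comp.
by rewrite (eq_map tinv_fletter).
Qed.

Lemma tmul_fword s t : tmul (enc_fword s) (enc_fword t) = enc_fword (foldr (@fpush n) t s).
Proof.
rewrite /tmul tlist_enc_seq; elim: s => //= a s ->.
case: (foldr _ _ s) => [|b r] //=.
by rewrite /tfpush /= tinv_fletter enc_fletter_eq; case: ifP.
Qed.

Lemma fg_size_gt0 (h : G) : (0 < size (fg_word h))%N = (h != 1).
Proof.
rewrite lt0n size_eq0; congr (~~ _); apply/eqP/eqP => [h0|-> //].
Qed.

Lemma tpush_enc l w :
  tpush (enc_letter l) (enc_seq (@enc_letter n) w) = enc_seq (@enc_letter n) (push l w).
Proof.
case: l w => [b|h] [|[d|k] w] //=; rewrite /tpush /=.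
- by case: b d => [] [].
- by rewrite isnode_enc_seq fg_size_gt0; case: eqP.
- by rewrite isnode_enc_seq fg_size_gt0; case: eqP.
- by rewrite tmul_fword isnode_enc_seq -fg_mulE fg_size_gt0; case: eqP.
Qed.

Lemma treduce_enc c :
  treduce (enc_seq (@enc_letter n) c) = enc_seq (@enc_letter n) (reduce c).
Proof.
by rewrite /treduce tlist_enc_seq; elim: c => //= l c ->; rewrite tpush_enc.
Qed.

Lemma tcount_enc w : tcount (enc_seq (@enc_letter n) w) = enc_nat (count (@is_x _) w).
Proof. by rewrite /tcount tlist_enc_seq; elim: w => //= -[b|h] w ->. Qed.

Definition fpow u (b : bool) := if b then rev (map (@finv n) u) else u.

Lemma tpow_enc u x b : tpow (enc_fword u) (Node x (enc_bool b)) = enc_fword (fpow u b).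
Proof. by rewrite /tpow /= isnode_enc_bool /fpow; case: b; rewrite ?twinv_fword. Qed.

Definition letter_word u l : fword n :=
  match l with inl b => fpow u b | inr h => h end.

Definition eval_word u c : fword n :=
  foldr (fun l t => foldr (@fpush n) t (letter_word u l)) [::] c.

Lemma fg_of_wordM s t : fg_of_word (s ++ t) = fg_of_word s * fg_of_word t.
Proof. exact: fg_of_word_cat. Qed.

Lemma fg_of_wordV s : fg_of_word (rev (map (@finv n) s)) = (fg_of_word s)^-1.
Proof.
apply: (mulIg (fg_of_word s)); rewrite mulVg -fg_of_wordM.
by apply: val_inj; rewrite /= freduce_invl.
Qed.

Lemma fg_of_word_letter u l :
  fg_of_word (letter_word u l) = eval_letter (fg_of_word u) l.
Proof.
case: l => [[]|h] //=; first exact: fg_of_wordV.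
exact: fg_of_wordK.
Qed.

Lemma eval_word_prod u c :
  fg_word (\prod_(l <- c) eval_letter (fg_of_word u) l) = eval_word u c.
Proof.
elim: c => [|l c IHc]; first by rewrite big_nil.
rewrite big_cons -fg_of_word_letter /= -IHc.
rewrite {1}/freduce foldr_cat -/(freduce (fg_word _)) freduce_id ?fg_wordP //.
by rewrite /freduce foldr_fpush_foldr ?fg_wordP.
Qed.

Lemma teval_enc u c :
  teval (enc_fword u) (enc_seq (@enc_letter n) c) = enc_fword (eval_word u c).
Proof.
rewrite /teval tlist_enc_seq; elim: c => //= l c ->.
by case: l => [b|h]; rewrite /= ?tpow_enc tmul_fword.
Qed.

End Encodings.

(** * Certificates are sound *)

Section Soundness.
Variables (n : nat) (gens : seq (fword n)) (u : fword n) (D Q N : seq tree).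
Notation G := (free_group n).
Notation enc := (@enc_fletter n).
Implicit Types (a : fletter n) (s t r : fword n).

Hypothesis D_ok : graph_ok (enc_seq (@enc_fword n) gens) D.
Hypothesis QN_saturated : saturated D (enc_fword u) Q N.

Lemma dstepP (p a : tree) : dstep D p a <> Leaf ->
  exists2 e, e \in D & [/\ hd e = p, hd (tl e) = a & tl (tl e) = dstep D p a].
Proof.
rewrite /dstep -[D]revK foldl_rev; elim: (rev D) => //= e s IHs.
case: ifP => [/andP[/eqP ep /eqP ea] _|_ /IHs[f fs Hf]].
  by exists e; rewrite // mem_rev mem_head.
by exists f; rewrite // mem_rev inE -mem_rev fs orbT.
Qed.

Lemma dstep_node (p a : tree) : dstep D p a <> Leaf -> p <> Leaf.
Proof.
case/dstepP=> e eD [<- _ _] e0; case/andP: D_ok => /allP/(_ _ eD).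
by rewrite e0.
Qed.

Lemma dstepK p a : dstep D p (enc a) <> Leaf ->
  dstep D (dstep D p (enc a)) (enc (finv a)) = p.
Proof.
case/dstepP=> e eD [ep ea <-]; case/andP: D_ok => /allP/(_ _ eD) /andP[_].
by rewrite ep ea tinv_fletter => /eqP.
Qed.

Definition read p s := drun D p (map enc s).

Lemma read_cat p s t : read p (s ++ t) = read (read p s) t.
Proof. by rewrite /read /drun map_cat foldl_cat. Qed.

Lemma read_node p s : read p s <> Leaf -> p <> Leaf.
Proof.
elim: s p => //= a s IHs p ps.
exact: dstep_node (IHs (dstep D p (enc a)) ps).
Qed.

Lemma read_push p a s :
  read p (a :: s) <> Leaf -> read p (fpush a s) = read p (a :: s).
Proof.
case: s => //= b s; case: eqP => // -> ps.
have p1 := @read_node (dstep D p (enc a)) (finv a :: s) ps.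
by rewrite -{1}(dstepK p1).
Qed.

Lemma read_reduce p s : read p s <> Leaf -> read p (freduce s) = read p s.
Proof.
elim: s p => //= a s IHs p ps.
have E : read p (a :: freduce s) = read p (a :: s) by apply: IHs.
by rewrite -/(freduce s) read_push E.
Qed.

Lemma read_inv p s : read p s <> Leaf ->
  read (read p s) (rev (map (@finv n) s)) = p.
Proof.
elim: s p => //= a s IHs p ps.
rewrite rev_cons -cats1 read_cat (IHs (dstep D p (enc a))) //.
by apply: dstepK; apply: (@read_node _ s).
Qed.

Lemma read_generated h : generated (map (@fg_of_word n) gens) h -> read base h = base.
Proof.
elim=> {h} [h /mapP[s sS ->]||h k _ IHh _ IHk|h _ IHh] //.
- have E : read base s = base.
    case/andP: D_ok => _ /allP/(_ (enc_fword s)); rewrite tlist_enc_seq map_f //.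
    by rewrite tlist_enc_seq => /(_ isT)/eqP.
  by rewrite /= read_reduce E.
- by rewrite /= read_reduce read_cat IHh IHk.
- have := @read_inv base h; rewrite IHh => E.
  by rewrite /= read_reduce E.
Qed.

Lemma N_refl (s : tree) : s \in Q -> Node s s \in N.
Proof. by case/and3P: QN_saturated => /allP Q_ok _ _ /Q_ok/andP[]. Qed.

Lemma N_trans (s t t' : tree) : Node s t \in N -> Node t t' \in N -> Node s t' \in N.
Proof.
case/and3P: QN_saturated => _ /allP N_ok _ /N_ok/allP st /st /=.
by rewrite eqxx.
Qed.

Lemma Q_pop (a v m : tree) : Node (Node a v) m \in Q -> Node v m \in Q.
Proof. by case/and3P: QN_saturated => /allP Q_ok _ _ /Q_ok/andP[]. Qed.

Lemma Q_succ (s t : tree) : s \in Q -> pending s = Leaf -> t \in succs D (enc_fword u) s ->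
  t \in Q /\ Node s t \in N.
Proof.
case/and3P: QN_saturated => /allP Q_ok _ _ /Q_ok/andP[_] + s0.
by rewrite s0 /= => /allP s_ok /s_ok/andP.
Qed.

Lemma N_cancel (a v m v' m' : tree) : Node (Node a v) m \in Q ->
  Node (Node v m) (Node (Node (tinv a) v') m') \in N ->
  Node (Node (Node a v) m) (Node v' m') \in N.
Proof.
case/and3P: QN_saturated => _ _ /allP QN_ok /QN_ok/allP s_ok /s_ok /=.
by rewrite !eqxx.
Qed.

(** The reduced word [r] can be spelled from [s] to [t] if the pairs in [N] are
    used as silent transitions. *)
Fixpoint reach (s : tree) r (t : tree) : Prop :=
  if r is a :: r' then
    exists v m, [/\ Node (Node (enc a) v) m \in Q,
                    Node s (Node (Node (enc a) v) m) \in N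
                  & reach (Node v m) r' t]
  else Node s t \in N.

Lemma reach_trans (s s' : tree) r (t : tree) : Node s s' \in N -> reach s' r t -> reach s r t.
Proof.
case: r => [|a r] /= ss'; first exact: N_trans.
by case=> v [m [vQ vN vr]]; exists v, m; split=> //; apply: N_trans vN.
Qed.

Lemma reach_push a (v m : tree) r (t : tree) : Node (Node (enc a) v) m \in Q ->
  reach (Node v m) r t -> reach (Node (Node (enc a) v) m) (fpush a r) t.
Proof.
move=> vQ vr.
have cons_r : reach (Node (Node (enc a) v) m) (a :: r) t.
  by exists v, m; split=> //; apply: N_refl.
case: r vr cons_r => //= b r; case: eqP => [-> [v' [m' [_ vN v'r]]] _|//].
by apply: reach_trans v'r; apply: N_cancel => //; rewrite tinv_fletter.
Qed.

Lemma reach_pending s (m : tree) r (t : tree) : Node (enc_fword s) m \in Q ->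
  reach (Node Leaf m) r t -> reach (Node (enc_fword s) m) (foldr (@fpush n) r s) t.
Proof.
elim: s => //= a s IHs sQ mr.
by apply: reach_push => //; apply: IHs => //; apply: Q_pop sQ.
Qed.

Lemma Q_pending s m : Node (enc_fword s) m \in Q -> Node Leaf m \in Q.
Proof. by elim: s => //= a s IHs /Q_pop. Qed.

Lemma reach_read b p s q l : freduced s -> read p s = q -> q <> Leaf ->
    (if s is a :: _ then tinv (enc a) != l else true) ->
    state Leaf b p l \in Q ->
  let l' := last l (map enc s) in
  state Leaf b q l' \in Q /\ forall r (t : tree),
    reach (state Leaf b q l') r t ->
    reach (state Leaf b p l) (foldr (@fpush n) r s) t.
Proof.
elim: s p l => [|a s IHs] p l /= rs; first by move=> <-.
move=> pq q0 al pQ.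
have p1 : dstep D p (enc a) <> Leaf by apply: (@read_node _ s); rewrite -pq in q0.
have [e eD [ep ea eq]] := dstepP p1.
have [] := @Q_succ _ (state (Node (enc a) Leaf) b (dstep D p (enc a)) (enc a)) pQ erefl.
  rewrite mem_cat; apply/orP; left; apply/mapP; exists e; last by rewrite ea eq.
  by rewrite mem_filter ep ea al eD eqxx.
move=> sQ sN; have mQ := Q_pop sQ.
have [] := IHs (dstep D p (enc a)) (enc a) _ pq q0 _ mQ.
- exact: path_sorted rs.
- by case: s rs {IHs pq} => //= k s /andP[ka _]; rewrite tinv_fletter enc_fletter_eq
    -(inj_eq (inv_inj (@finvK n))) finvK.
move=> qQ qr; split=> // r t /qr mr; apply: reach_trans sN _.
exact: reach_push.
Qed.

Lemma reach_word (w : word G) b (l : tree) :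
    reduced w -> (forall h, inr h \in w -> generated (map (@fg_of_word n) gens) h) ->
    (count (@is_x _) w <= b)%N ->
    match w return Prop with
    | inl c :: _ => tinv (xlet c) != l
    | inr _ :: _ => l = Leaf \/ exists c, l = xlet c
    | [::] => True
    end ->
    state Leaf (enc_nat b) base l \in Q ->
  exists b' l', reach (state Leaf (enc_nat b) base l) (eval_word u w)
                      (state Leaf b' base l') /\ (w <> [::] \/ l <> Leaf -> l' <> Leaf).
Proof.
elim: w b l => [|x w IHw] b l rw Hw bw wl lQ.
  by exists (enc_nat b), l; split; [apply: N_refl|case].
have rw' := reduced_cons rw.
have Hw' h : inr h \in w -> generated (map (@fg_of_word n) gens) h.
  by move=> hw; apply: Hw; rewrite inE hw orbT.
case: x rw Hw bw wl => [c|h] rw Hw bw wl.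
- case: b bw lQ => // b bw lQ.
  have [] := @Q_succ _ (state (enc_fword (fpow u c)) (enc_nat b) base (xlet c)) lQ erefl.
    rewrite mem_cat; apply/orP; right; apply/mapP.
    exists (xlet c); last by rewrite tpow_enc.
    by rewrite mem_filter wl; case: (c).
  move=> sQ sN; have mQ := Q_pending sQ.
  have [] // := IHw b (xlet c) rw' Hw' bw _ mQ.
    case: w rw {IHw rw' Hw Hw' bw} => // -[d|h] w; last by right; exists c.
    by case/andP=> _ /= /andP[/eqP-> _]; case: d.
  move=> b' [l' [br l'0]]; exists b', l'; split.
    by apply: reach_trans sN _; apply: reach_pending.
  by move=> _; apply: l'0; right.
have [] := @reach_read (enc_nat b) base h base l (fg_wordP h) _ _ _ lQ.
- by apply: read_generated; apply: Hw; rewrite mem_head.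
- by [].
- case: (fg_word h) => // a s; case: wl => [->|[c ->]] //.
  by case: a => [[[|i] ?] ?].
set l' := last _ _ => l'Q hr.
have l'E : exists2 a, l' = enc a & true.
  case/andP: rw => /= /andP[+ _] _; rewrite -fg_size_gt0 /l'.
  case/lastP: (fg_word h) => // s a _; exists a => //.
  by rewrite map_rcons last_rcons.
have [a l'a _] := l'E.
have [] // := IHw b l' rw' Hw' bw _ l'Q.
  case: w rw {IHw rw' Hw Hw' bw} => // -[c|k] w; last by case/andP.
  by move=> _; rewrite l'a; case: (a) => [[[|i] ?] ?].
move=> b' [l'' [br l''0]]; exists b', l''; split; first exact: hr.
by move=> _; apply: l''0; right; rewrite l'a.
Qed.

Lemma lower_bound (w : word G) b :
    excluded (state Leaf (enc_nat b) base Leaf) Q N ->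
    reduced w -> (forall h, inr h \in w -> generated (map (@fg_of_word n) gens) h) ->
    (count (@is_x _) w <= b)%N -> w <> [::] -> eval_word u w <> [::].
Proof.
case/andP=> sQ /allP Hexcl rw Hw bw w0 ew.
have [] // := reach_word rw Hw bw _ sQ.
  by case: w {Hw bw w0 ew} rw => // -[c|h] w _ //; left.
move=> b' [l' []]; rewrite ew => /= /Hexcl; rewrite /pending /vertex /= !eqxx /=.
by move=> /eqP; rewrite /state => -[_ ->] /(_ (or_introl w0)).
Qed.

End Soundness.

(** * Certificates exist *)

Lemma exists_filter (T : eqType) (P : T -> Prop) (l : seq T) :
  exists l' : seq T, forall x, x \in l' <-> x \in l /\ P x.
Proof.
elim: l => [|y l [l' IHl]]; first by exists [::] => x; split=> // -[].
have [Py|nPy] := classic (P y).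
  exists (y :: l') => x; rewrite !inE; split.
    by case/orP=> [/eqP->|/IHl[-> Px]]; rewrite ?eqxx ?orbT.
  by case=> /orP[->|xl Px] //; apply/orP; right; apply/IHl.
exists l' => x; rewrite inE; split=> [/IHl[-> Px]|[/orP[/eqP->|xl] Px]] //.
  by rewrite orbT.
exact/IHl.
Qed.

Lemma exists_transversal (G : groupType) (S l : seq G) :
  exists T : seq G, [/\ 1 \in T,
    forall z, z \in l -> exists2 p, p \in T & generated S (z * p^-1)
  & forall p q, p \in T -> q \in T -> generated S (p * q^-1) -> p = q].
Proof.
elim: l => [|z l [T [T1 Tl Tinj]]].
  exists [:: 1]; split; [exact: mem_head|by move=> z; rewrite in_nil|].
  by move=> p q; rewrite !inE => /eqP-> /eqP->.
have [[p pT Hzp]|nz] := classic (exists2 p, p \in T & generated S (z * p^-1)).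
  exists T; split=> // z'; rewrite inE => /orP[/eqP->|/Tl//].
  by exists p.
exists (z :: T); split.
- by rewrite inE T1 orbT.
- move=> z'; rewrite inE => /orP[/eqP->|/Tl[p pT Hp]].
    by exists z; rewrite ?mem_head // mulgV; apply: generated1.
  by exists p; rewrite // inE pT orbT.
- move=> p q; rewrite !inE => /orP[/eqP->|pT] /orP[/eqP->|qT] Hpq //.
  + by case: nz; exists q.
  + by case: nz; exists p => //; move/generatedV: Hpq; rewrite invgM invgK.
  + exact: Tinj.
Qed.

Section Words.
Variable G : groupType.
Implicit Types (w : word G) (j k : letter G).

Lemma reduced_rcons2 w j k :
  reduced (rcons (rcons w j) k) =
  [&& reduced (rcons w j), proper_letter k & may_follow j k].
Proof.
have -> : reduced (rcons (rcons w j) k) =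
    (proper_letter k && all (@proper_letter G) (rcons w j)) &&
    (sorted (@may_follow G) (rcons w j) && may_follow j k).
  rewrite /reduced all_rcons; congr (_ && _).
  by case: w => [|i w] /=; rewrite ?andbT // [LHS]rcons_path last_rcons.
by rewrite [proper_letter k && _]andbC andbACA.
Qed.

End Words.

Inductive cancels D u : tree -> tree -> Prop :=
| cancels_refl s : cancels D u s s
| cancels_trans s t t' : cancels D u s t -> cancels D u t t' -> cancels D u s t'
| cancels_succ s t : pending s = Leaf -> t \in succs D u s -> cancels D u s t
| cancels_cancel a v m v' m' :
    cancels D u (Node v m) (Node (Node (tinv a) v') m') ->
    cancels D u (Node (Node a v) m) (Node v' m').

Section Completeness.
Variables (n : nat) (gens : seq (fword n)) (u : fword n) (b : nat).
Notation G := (free_group n).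
Notation H := (generated (map (@fg_of_word n) gens)).
Notation g := (fg_of_word u).
Notation enc := (@enc_fletter n).
Implicit Types (a : fletter n) (s : fword n) (w : word G) (y z p q : G).

Definition vert p := Node Leaf (enc_fword p).
Definition edge (x : G * G * fletter n) :=
  Node (vert x.1.1) (Node (enc x.2) (vert x.1.2)).

Lemma vert_inj : injective vert.
Proof. by move=> p q [/enc_fword_inj/fg_word_inj]. Qed.

Lemma exists_graph : exists2 D : seq tree, graph_ok (enc_seq (@enc_fword n) gens) D &
  forall e, e \in D -> exists p q a,
    e = edge (p, q, a) /\ H (p * fg_of_word [:: a] * q^-1).
Proof.
pose prefixes := flatten [seq [seq fg_of_word (take i s) | i <- iota 0 (size s).+1] | s <- gens].
have [T [T1 Tpre Tinj]] := exists_transversal (map (@fg_of_word n) gens) prefixes.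
have [X XP] := exists_filter
  (fun x : G * G * fletter n => H (x.1.1 * fg_of_word [:: x.2] * x.1.2^-1))
  [seq (x, a) | x <- [seq (p, q) | p <- T, q <- T], a <- enum {: fletter n}].
have XE p q a : (p, q, a) \in X <-> [/\ p \in T, q \in T & H (p * fg_of_word [:: a] * q^-1)].
  rewrite XP /=; split=> [[/allpairsP[[x a'] /= [/allpairsP[[p' q'] /= [pT qT ->]] _ [-> -> _]]]]|] //.
  case=> pT qT Hpq; split=> //; apply: allpairs_f; last by rewrite mem_enum.
  exact: allpairs_f.
pose D := map edge X.
have stepE p q a : p \in T -> q \in T -> H (p * fg_of_word [:: a] * q^-1) ->
    dstep D (vert p) (enc a) = vert q.
  move=> pT qT Hpq.
  have eD : edge (p, q, a) \in rev D by rewrite mem_rev map_f //; apply/XE.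
  have uniq_q e : e \in rev D -> hd e = vert p -> hd (tl e) = enc a -> tl (tl e) = vert q.
    rewrite mem_rev => /mapP[[[p' q'] a'] /XE[_ q'T Hp'] -> /=].
    move=> /vert_inj pp /enc_fletter_inj aa; subst p' a'; congr vert.
    apply: Tinj => //.
    have -> : q' * q^-1 = (p * fg_of_word [:: a] * q'^-1)^-1 * (p * fg_of_word [:: a] * q^-1).
      by rewrite !invgM !invgK !mulgA mulgVK mulgVK.
    by apply: generatedM => //; apply: generatedV.
  rewrite /dstep -[D]revK foldl_rev; move: (rev D) eD uniq_q => E; elim: E => //= e E IHE.
  rewrite inE => /orP[/eqP <-|eE] uq.
    by rewrite /= !eqxx.
  case: ifP => [/andP[/eqP ep /eqP ea]|_]; first by apply: uq; rewrite ?mem_head.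
  by apply: IHE => // f fE; apply: uq; rewrite inE fE orbT.
exists D.
  apply/andP; split; apply/allP.
    move=> _ /mapP[[[p q] a] /XE[pT qT Hpq] ->] /=; apply/eqP; rewrite tinv_fletter.
    apply: stepE => //; move/generatedV: Hpq; rewrite !invgM invgK.
    by rewrite -fg_of_wordV mulgA.
  move=> t; rewrite tlist_enc_seq => /mapP[s sS ->{t}]; apply/eqP.
  have read s1 s2 p : s1 ++ s2 = s -> p \in T -> H (fg_of_word s1 * p^-1) ->
      exists q, [/\ q \in T, H (fg_of_word s * q^-1) & drun D (vert p) (map enc s2) = vert q].
    elim: s2 s1 p => [|a s2 IHs] s1 p.
      by rewrite cats0 => <- pT Hp; exists p.
    move=> s12 pT Hp.
    have s12' : rcons s1 a ++ s2 = s by rewrite cat_rcons.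
    have [|q qT Hq] := Tpre (fg_of_word (rcons s1 a)).
      apply/flatten_mapP; exists s => //; apply/mapP; exists (size s1).+1.
        by rewrite mem_iota -s12' size_cat size_rcons ltnS leq_addr.
      by rewrite -s12' -(size_rcons s1 a) take_size_cat.
    have Hpq : H (p * fg_of_word [:: a] * q^-1).
      have -> : p * fg_of_word [:: a] * q^-1 =
          (fg_of_word s1 * p^-1)^-1 * (fg_of_word (rcons s1 a) * q^-1).
        by rewrite -cats1 fg_of_wordM invgM invgK !mulgA mulgVK.
      by apply: generatedM => //; apply: generatedV.
    have [r [rT Hr rE]] := IHs _ _ s12' qT Hq.
    by exists r; split=> //=; rewrite -rE -(stepE _ _ _ pT qT Hpq).
  have [//|//||q [qT Hq]] := read [::] s 1.
    by rewrite -[fg_of_word _]/(1 : G) mulgV; apply: generated1.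
  rewrite tlist_enc_seq => ->.
  suff -> : q = 1 by [].
  apply: Tinj => //; rewrite invg1 mulg1.
  have -> : q = (fg_of_word s * q^-1)^-1 * fg_of_word s by rewrite invgM invgK mulgVK.
  apply: generatedM; first exact: generatedV.
  by apply: generated_mem; apply: map_f.
by move=> _ /mapP[[[p q] a] /XE[_ _ Hpq] ->]; exists p, q, a.
Qed.


(** A partially guessed word is [w] followed by the coefficient [z] that is still
    being read, so that [w] is empty or ends with [x] or its inverse. *)
Definition label w z : tree :=
  last (if last (inr 1) w is inl c then xlet c else Leaf) (map enc z).

Definition segment w z := if z == 1 then w else rcons w (inr z).

Definition x_last w := w = [::] \/ exists w' c, w = rcons w' (inl c).

Lemma segment_reduced w z : reduced w -> x_last w -> reduced (segment w z).
Proof.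
rewrite /segment; case: eqVneq => // z1 rw [w0|[w' [c wE]]]; subst w.
  by move: z1; rewrite /reduced /= => ->.
by move: z1; rewrite reduced_rcons2 rw /= => ->.
Qed.

Lemma segment_count w z : count (@is_x _) (segment w z) = count (@is_x _) w.
Proof. by rewrite /segment; case: ifP; rewrite // -cats1 count_cat /= !addn0. Qed.

Lemma segment_over w z : (forall h, inr h \in w -> H h) -> H z ->
  forall h, inr h \in segment w z -> H h.
Proof.
move=> Hw Hz h; rewrite /segment; case: ifP => _; first exact: Hw.
by rewrite mem_rcons inE => /orP[/eqP[->]|/Hw].
Qed.

Lemma segment_prod w z :
  \prod_(x <- segment w z) eval_letter g x = \prod_(x <- w) eval_letter g x * z.
Proof.
rewrite /segment; case: eqP => [->|_]; first by rewrite mulg1.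
by rewrite -cats1 big_cat big_seq1.
Qed.

(** Some partially guessed word leads to the state [s] after [y] has been spelled. *)
Definition tracks (s : tree) y := exists (v : fword n) w z c p,
  [/\ s = state (enc_fword v) (enc_nat c) (vert p) (label w z),
      [/\ reduced w, x_last w & forall h, inr h \in w -> H h],
      (count (@is_x _) w + c = b)%N,
      H (z * p^-1)
    & y * fg_of_word v = \prod_(x <- w) eval_letter g x * z].

Section Invariant.
Variable D : seq tree.
Hypothesis D_edges : forall e, e \in D -> exists p q a,
  e = edge (p, q, a) /\ H (p * fg_of_word [:: a] * q^-1).

Lemma tracks_pop (a v m : tree) y : tracks (Node (Node a v) m) y ->
  exists2 a0, a = enc a0 & tracks (Node v m) (y * fg_of_word [:: a0]).
Proof.
case=> -[|a0 v0] [w [z [c [p [sE Hw Hc Hz yE]]]]] //.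
case: sE => -> -> ->; exists a0 => //; exists v0, w, z, c, p; split=> //.
by rewrite -yE -mulgA -fg_of_wordM.
Qed.

Lemma fg_mul_letter z a : (if fg_word z is k :: z' then a != finv (last k z') else true) ->
  fg_word (z * fg_of_word [:: a]) = rcons z a.
Proof.
move=> za; rewrite -{1}[z]fg_of_wordK -fg_of_wordM cats1 /= freduce_id //.
have := fg_wordP z; rewrite /freduced; case: (fg_word z) za => //= k s za rs.
by rewrite rcons_path rs.
Qed.

Lemma label_last w z c : last (inr 1) w = inl c -> z = 1 -> label w z = xlet c.
Proof. by rewrite /label => -> ->. Qed.

Lemma tracks_succ (s t : tree) y : pending s = Leaf -> t \in succs D (enc_fword u) s ->
  tracks s y -> tracks t y.
Proof.
move=> s0 ts [v [w [z [c [p [sE [rw w_x Hw] wc Hz yE]]]]]].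
have v0 : v = [::] by move: s0; rewrite sE; case: (v).
subst v; move: ts; rewrite sE mem_cat => /orP[/mapP[e]|].
  rewrite mem_filter => /andP[/andP[]]; rewrite /vertex /prior /=.
  move=> /eqP ep el /D_edges[p' [q [a [eE Hpq]]]].
  move: ep el; rewrite {}eE /= => /vert_inj pp; subst p'; rewrite tinv_fletter => al ->.
  have za : fg_word (z * fg_of_word [:: a]) = rcons z a.
    apply: fg_mul_letter; move: al; rewrite /label.
    case: (fg_word z) => //= k s'; rewrite last_map enc_fletter_eq.
    by apply: contra => /eqP->; rewrite finvK.
  exists [:: a], w, (z * fg_of_word [:: a]), c, q; split=> //.
  - by rewrite /label za map_rcons last_rcons.
  - have -> : z * fg_of_word [:: a] * q^-1 = (z * p^-1) * (p * fg_of_word [:: a] * q^-1).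
      by rewrite !mulgA mulgVK.
    exact: generatedM.
  - by rewrite mulgA -yE -mulgA; congr (_ * _); rewrite -fg_of_wordM.
case: ifP => // /andP[/eqP pb c0] /mapP[x]; rewrite mem_filter => /andP[xl x_in].
have p1 : p = 1 by apply: vert_inj; exact: pb.
have [d xE] : exists d, x = xlet d.
  by move: x_in; rewrite !inE => /orP[]/eqP->; [exists false|exists true].
rewrite {}xE {x x_in} in xl *; rewrite tpow_enc /budget /= => ->.
case: c c0 wc {sE} xl pb => // c _ wc xl pb.
have Hz1 : H z by move: Hz; rewrite p1 invg1 mulg1.
exists (fpow u d), (rcons (segment w z) (inl d)), 1, c, 1; split=> //.
- by rewrite (@label_last _ _ d) // last_rcons.
- split; last first.
  + move=> h; rewrite mem_rcons inE => /orP[//|]; exact: segment_over.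
  + by right; exists (segment w z), d.
  have := segment_reduced z rw w_x; move: xl; rewrite /segment /label /prior /=.
  case: (eqVneq z 1) => [->|z1] /=; last by rewrite reduced_rcons2 => _ ->.
  case: w_x {rw wc Hw yE} => [->|[w' [e ->]]] //.
  by rewrite last_rcons reduced_rcons2 => de -> /=; case: e d de => [] [].
- by rewrite -cats1 count_cat segment_count -wc -addnA.
- by rewrite mulgV; apply: generated1.
- rewrite mulg1 -cats1 big_cat big_seq1 segment_prod -yE.
  by rewrite -(fg_of_word_letter u (inl d)) -[fg_of_word [::]]/(1 : G) mulg1.
Qed.

Lemma tracks_cancels (s t : tree) : cancels D (enc_fword u) s t -> forall y, tracks s y -> tracks t y.
Proof.
elim=> {s t} [//|s t t' _ IH1 _ IH2 y /IH1/IH2//|s t s0 ts y|a v m v' m' _ IH y].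
  exact: tracks_succ.
case/tracks_pop=> a0 aE /IH; rewrite aE tinv_fletter => /tracks_pop[a1 /enc_fletter_inj<-].
rewrite -mulgA -fg_of_wordM (_ : fg_of_word _ = 1) ?mulg1 //.
by apply: fg_word_inj; rewrite /= /freduce /= eqxx.
Qed.

End Invariant.

Hypothesis minimal : forall w, reduced w -> (forall h, inr h \in w -> H h) ->
  w <> [::] -> (count (@is_x _) w <= b)%N -> \prod_(x <- w) eval_letter g x <> 1.

Lemma cancels_start (D : seq tree) (t : tree) :
  (forall e, e \in D -> exists p q a,
    e = edge (p, q, a) /\ H (p * fg_of_word [:: a] * q^-1)) ->
  cancels D (enc_fword u) (state Leaf (enc_nat b) base Leaf) t ->
  pending t = Leaf -> vertex t = base -> t = state Leaf (enc_nat b) base Leaf.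
Proof.
move=> D_edges /(tracks_cancels D_edges)/(_ 1)[].
  exists [::], [::], 1, b, 1; split=> //.
  - by split=> //; left.
  - by rewrite mulgV; apply: generated1.
  - by rewrite big_nil.
move=> v [w [z [c [p [-> [rw w_x Hw] wc Hz yE]]]]] v0 pb.
have vn : v = [::] by move: v0; case: (v).
have p1 : p = 1 by apply: vert_inj; exact: pb.
have Hz1 : H z by move: Hz; rewrite p1 invg1 mulg1.
subst v p; have [w0|/eqP w1] := eqVneq (segment w z) [::].
  have [z1 wn] : z = 1 /\ w = [::].
    move: w0; rewrite /segment; case: eqP => [-> ->|_] //.
    by case: (w).
  by subst z w; rewrite -wc.
case: (minimal (segment_reduced z rw w_x) (segment_over Hw Hz1) w1 _).
  by rewrite segment_count -wc leq_addr.
by rewrite segment_prod -yE mul1g.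
Qed.

Lemma exists_certificate : exists (D Q N : seq tree),
  [/\ graph_ok (enc_seq (@enc_fword n) gens) D, saturated D (enc_fword u) Q N
    & excluded (state Leaf (enc_nat b) base Leaf) Q N].
Proof.
have [D D_ok D_edges] := exists_graph.
pose K := (\max_(e <- D) depth e + depth (enc_fword (fpow u false)) +
  depth (enc_fword (fpow u true)) + b + 5)%N.
pose U := tlist (iter K.+4 next_trees Leaf).
have [Q QE] := exists_filter (fun s : tree => exists v r p l : tree, s = state v r p l /\
  [/\ depth v <= K, depth r <= K, depth p <= K & depth l <= K])%N U.
have [N NE] := exists_filter (fun e : tree => exists s t : tree, [/\ e = Node s t, s \in Q, t \in Q
  & cancels D (enc_fword u) s t]) [seq Node e f | e <- Q, f <- Q].
have in_Q (v r p l : tree) : state v r p l \in Q <->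
    [/\ depth v <= K, depth r <= K, depth p <= K & depth l <= K]%N.
  split; first by case/QE=> _ [v' [r' [p' [l' [[-> -> -> ->]]]]]].
  move=> [dv dr dp dl]; apply/QE; split; last by exists v, r, p, l.
  by rewrite mem_iter_next_trees /=; lia.
have in_N (s t : tree) : Node s t \in N <-> [/\ s \in Q, t \in Q & cancels D (enc_fword u) s t].
  split; first by case/NE=> _ [s' [t' [[-> ->]]]].
  by move=> [sQ tQ st]; apply/NE; split; [exact: allpairs_f|exists s, t].
have Q_state (s : tree) : s \in Q -> exists v r p l : tree, s = state v r p l.
  by case/QE=> _ [v [r [p [l [-> _]]]]]; exists v, r, p, l.
have Q_pop (a v m : tree) : Node (Node a v) m \in Q -> Node v m \in Q.
  move=> sQ; have [v' [r [p [l [_ mE]]]]] := Q_state _ sQ; subst m.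
  case/in_Q: sQ => /= dv dr dp dl; apply/in_Q; split=> //; lia.
have Q_succ (s t : tree) : s \in Q -> t \in succs D (enc_fword u) s -> t \in Q.
  move=> sQ; have [v [r [p [l sE]]]] := Q_state _ sQ; subst s.
  case/in_Q: sQ => /= dv dr dp dl; rewrite mem_cat => /orP[/mapP[e]|].
    rewrite mem_filter => /andP[_ eD] ->.
    have /leq_trans le_e : (depth e <= \max_(e <- D) depth e)%N by exact: leq_bigmax_seq.
    have [q [q' [a [eE _]]]] := D_edges _ eD; subst e.
    apply/in_Q; move: (le_e K) => /=; rewrite /budget /= => le_K.
    by have := le_K ltac:(rewrite /K; lia); split=> //=; lia.
  case: ifP => // _ /mapP[x]; rewrite mem_filter => /andP[_ x_in ->].
  apply/in_Q; split.
  - by move: x_in; rewrite !inE => /orP[]/eqP->; rewrite tpow_enc /K; lia.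
  - by move: dr; rewrite /budget; case: (r) => //= ? ?; lia.
  - by rewrite /K /=; lia.
  - by move: x_in; rewrite !inE => /orP[]/eqP->; rewrite /K /=; lia.
exists D, Q, N; split=> //.
  apply/and3P; split.
  - apply/allP=> s sQ; apply/andP; split; first by apply/in_N; split=> //; constructor.
    have [v [r [p [l sE]]]] := Q_state _ sQ; subst s; case: v sQ => [|a v] sQ /=.
      apply/allP=> t ts; have tQ := Q_succ _ _ sQ ts; rewrite tQ.
      by apply/in_N; split=> //; apply: cancels_succ.
    exact: Q_pop sQ.
  - apply/allP=> e eN; apply/allP=> f fN; apply/implyP=> /eqP.
    case/NE: (eN) => _ [s [t [eE _ _ _]]]; case/NE: (fN) => _ [s' [t' [fE _ _ _]]].
    subst e f => /= ts; subst s'; case/in_N: eN => sQ _ st; case/in_N: fN => _ tQ tt.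
    by apply/in_N; split=> //; apply: cancels_trans tt.
  - apply/allP=> s sQ; apply/allP=> e eN; apply/implyP.
    case/NE: (eN) => _ [s' [t [eE _ tQ _]]]; subst e.
    have [[|a v] [r [p [l sE]]]] := Q_state _ sQ; subst s => //.
    have [[|a' v'] [r' [p' [l' tE]]]] := Q_state _ tQ; subst t => //=.
    case/andP=> /eqP s'E /eqP a'E; rewrite -s'E a'E in eN tQ *.
    case/in_N: eN => _ _ st; apply/in_N; split=> //; first exact: Q_pop tQ.
    exact: cancels_cancel.
apply/andP; split; first by apply/in_Q; rewrite /K /=; split=> //; try lia;
  by elim: (b) => //= k; lia.
apply/allP=> e eN; case/NE: (eN) => _ [s [t [eE _ _ st]]]; subst e; apply/implyP=> /=.
case/and3P=> /eqP sE t0 /eqP tb; subst s; apply/eqP; apply: cancels_start D_edges st _ tb.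
by case: (pending t) t0.
Qed.

End Completeness.

(** * The theorem *)

Lemma exists_minimizer (T : Type) (P : T -> Prop) (m : T -> nat) :
  (exists x, P x) -> exists2 x, P x & forall y, P y -> m x <= m y.
Proof.
case=> x Px; have [k] := ubnP (m x); elim: k x Px => // k IHk x Px mx.
have [[y [Py yx]]|nlt] := classic (exists y, P y /\ m y < m x).
  by apply: (IHk y) => //; apply: leq_trans yx mx.
exists x => // y Py; rewrite leqNgt; apply/negP => yx; apply: nlt.
by exists y.
Qed.

Section CyclicReduction.
Variables (G : groupType) (H : G -> Prop).
Hypothesis HM : forall h k, H h -> H k -> H (h * k).
Implicit Types w : word G.

Lemma cyclic_step_count w : count (@is_x G) (cyclic_step w) <= count (@is_x G) w.
Proof.
case: w => [|l w] //; case/lastP: w => [|w z] //; rewrite cyclic_step_rcons.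
by case: l z => [b|h] [c|k] //; case: ifP => _ //=;
  rewrite -?cats1 ?count_cat /=; lia.
Qed.

Lemma cyclic_step_over w : (forall h, inr h \in w -> H h) ->
  forall h, inr h \in cyclic_step w -> H h.
Proof.
case: w => [|l w] //; case/lastP: w => [|w z] //; rewrite cyclic_step_rcons => Hw.
have Hw' h : inr h \in w -> H h.
  by move=> hw; apply: Hw; rewrite inE mem_rcons inE hw !orbT.
case: l z Hw => [b|h] [c|k] Hw j //; try exact: Hw; case: ifP => _; try exact: Hw; try exact: Hw'.
rewrite mem_rcons inE => /orP[/eqP[->]|/Hw'//].
by apply: HM; apply: Hw; rewrite !inE ?mem_rcons ?inE eqxx ?orbT.
Qed.

Lemma degree_le_count (w : free_prod G) : degree w <= count (@is_x G) w.
Proof.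
rewrite /degree /cyclic_reduction; elim: (size w) => //= m IHm.
exact: leq_trans (cyclic_step_count _) IHm.
Qed.

Lemma cyclic_reduction_over w : (forall h, inr h \in w -> H h) ->
  forall h, inr h \in cyclic_reduction w -> H h.
Proof.
by move=> Hw; rewrite /cyclic_reduction; elim: (size w) => //= m; apply: cyclic_step_over.
Qed.

End CyclicReduction.

Section Equations.
Variables (n : nat) (gens : seq (fword n)) (u : fword n).
Notation G := (free_group n).
Notation H := (generated (map (@fg_of_word n) gens)).
Notation g := (fg_of_word u).
Implicit Types w c : word G.

Record equation w : Prop := Equation {
  equation_reduced : reduced w;
  equation_coef : forall h, inr h \in w -> H h;
  equation_neq0 : w <> [::];
  equation_root : \prod_(x <- w) eval_letter g x = 1 }.

Lemma equation_count w : equation w -> 0 < count (@is_x G) w.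
Proof.
case=> rw _ w0 w1; rewrite lt0n; apply/eqP => /eqP.
rewrite -leqn0 leqNgt -has_count => nx.
case: w rw w0 w1 nx => [|[b|h] [|[d|k] w]] // rw _; last by case/andP: rw => _ /andP[].
by rewrite big_seq1 /= => h1; move: rw; rewrite /reduced /= h1 eqxx.
Qed.

Lemma equation_of_ideal (w : free_prod G) :
  eqn_ideal H g w -> w <> 1 -> equation (cyclic_reduction w).
Proof.
move=> [wH w1] wn.
have /andP[rw _] := cyclic_reductionP (fp_wordP w).
have [v vE] := cyclic_reduction_conj w; rewrite fp_of_wordK in vE.
split=> //.
- by apply: cyclic_reduction_over wH; exact: generatedM.
- move=> w0; apply: wn; apply: (conjg_inj v); rewrite conj1g -vE w0.
  by [].
- rewrite -phi_of_word vE conjgE !phi_morph w1 mul1g -phi_morph mulVg.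
  by apply: etrans (phi_of_word _ [::]) _; rewrite big_nil.
Qed.

Lemma over_gensP t : over_gens (enc_seq (@enc_fword n) gens) t ->
  exists2 c, t = enc_seq (@enc_letter n) c & forall h, inr h \in c -> H h.
Proof.
rewrite /over_gens tlist_enc_seq; elim: t => [|e _ t IHt] /=; first by exists [::].
case/andP=> eP /IHt[c -> Hc]; case/or3P: eP => [/eqP->|/eqP->|].
- by exists (inl false :: c) => // h; rewrite inE => /Hc.
- by exists (inl true :: c) => // h; rewrite inE => /Hc.
case/hasP=> _ /mapP[s sS ->]; rewrite twinv_fword !(@tmul_fword n _ [::]).
have Hs : H (fg_of_word s) by apply/generated_mem/map_f.
case/orP=> /eqP->.
  exists (inr (fg_of_word s) :: c) => // h.
  by rewrite inE => /orP[/eqP[->]|/Hc].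
exists (inr (fg_of_word s)^-1 :: c); first by rewrite -fg_of_wordV.
move=> h; rewrite inE => /orP[/eqP[->]|/Hc //]; exact: generatedV.
Qed.

Definition gen_letter (l : letter G) := match l with
  | inl _ => true
  | inr h => has (fun s => (h == fg_of_word s) || (h == (fg_of_word s)^-1)) gens
  end.

Lemma over_gens_enc c : all gen_letter c ->
  over_gens (enc_seq (@enc_fword n) gens) (enc_seq (@enc_letter n) c).
Proof.
rewrite /over_gens !tlist_enc_seq all_map; apply: sub_all => -[[]|h] //= /hasP[s sS hs].
apply/hasP; exists (enc_fword s); first exact: map_f.
rewrite twinv_fword !(@tmul_fword n _ [::]).
by case/orP: hs => /eqP->; rewrite -?fg_of_wordV eqxx ?orbT.
Qed.

Lemma exists_gen_word w : (forall h, inr h \in w -> H h) ->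
  exists2 c, all gen_letter c & fp_of_word c = fp_of_word w.
Proof.
have coef h : H h -> exists2 c, all gen_letter c & fp_of_word c = fp_of_word [:: inr h].
  elim=> {h} [h /mapP[s sS ->]||h k _ [c cg ch] _ [d dg dk]|h _ [c cg ch]].
  - exists [:: inr (fg_of_word s)] => //=; rewrite andbT.
    by apply/hasP; exists s; rewrite ?eqxx.
  - by exists [::] => //; apply: fp_word_inj; rewrite /= /reduce /= ?eqxx.
  - exists (c ++ d); first by rewrite all_cat cg.
    rewrite fp_of_wordM ch dk -fp_of_wordM; apply: fp_word_inj.
    exact: push_coef.
  - exists (rev (map (@linv G) c)).
      rewrite all_rev all_map; apply: sub_all cg => -[//|k] /= /hasP[s sS ks].
      by apply/hasP; exists s => //; case/orP: ks => /eqP->; rewrite ?invgK eqxx ?orbT.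
    apply: (mulIg (fp_of_word c)); rewrite -fp_of_wordM ch -fp_of_wordM.
    apply: fp_word_inj; rewrite [LHS]reduce_invl.
    by apply/esym; exact: (@pushK _ (inr h) [::]).
elim: w => [|l w IHw] Hw; first by exists [::].
have [|c cg cw] := IHw; first by move=> h hw; apply: Hw; rewrite inE hw orbT.
have [d dg dl] : exists2 d, all gen_letter d & fp_of_word d = fp_of_word [:: l].
  case: l Hw => [b|h] Hw; first by exists [:: inl b].
  by apply: coef; apply: Hw; rewrite mem_head.
exists (d ++ c); first by rewrite all_cat dg.
by rewrite fp_of_wordM cw dl -fp_of_wordM.
Qed.

Lemma start_enc w : start (enc_seq (@enc_letter n) w) =
  state Leaf (enc_nat (count (@is_x G) w).-1) base Leaf.
Proof. by rewrite /start tcount_enc; case: (count _ w). Qed.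

Lemma check_complete : depends_on H g -> exists cert, check (enc_input gens u) cert.
Proof.
case=> w [wI w1].
have [w0 w0E w0_min] := exists_minimizer (count (@is_x G))
  (ex_intro _ _ (equation_of_ideal wI w1)).
have [c cg cw] := exists_gen_word (equation_coef w0E).
have w0_red : reduce c = w0.
  by rewrite -(reduce_id (equation_reduced w0E)) -[LHS]/(fp_word (fp_of_word c)) cw.
have [|D [Q [N [D_ok QN_ok excl]]]] := @exists_certificate n gens u (count (@is_x G) w0).-1.
  move=> v rv Hv v0 v_lt v1; have := leq_trans (w0_min v (Equation rv Hv v0 v1)) v_lt.
  by have := equation_count w0E; case: (count _ w0) => //= k; rewrite ltnn.
exists (Node (enc_seq (@enc_letter n) c) (Node (olist D) (Node (olist Q) (olist N)))).
rewrite /check /= !olistK D_ok QN_ok over_gens_enc //= treduce_enc w0_red start_enc excl.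
rewrite isnode_enc_seq teval_enc isnode_enc_seq -eval_word_prod -phi_of_word cw.
rewrite phi_of_word (equation_root w0E) /= !andbT.
by case: (w0) (equation_neq0 w0E).
Qed.

Lemma check_sound cert : check (enc_input gens u) cert ->
  exists w : free_prod G, [/\ output cert = enc_equation w, eqn_ideal H g w, w <> 1
    & forall w' : free_prod G, eqn_ideal H g w' -> w' <> 1 -> degree w <= degree w'].
Proof.
case: cert => [|t cert] //; rewrite /check /output /=.
case/and5P=> /over_gensP[c -> Hc]; rewrite treduce_enc isnode_enc_seq teval_enc.
rewrite isnode_enc_seq start_enc => c0 ce D_ok /andP[QN_ok excl].
exists (fp_of_word c); split=> //.
- split; first by apply: equation_over_fp_of_word => //; exact: generatedM.
  rewrite phi_of_word; apply: fg_word_inj; rewrite eval_word_prod.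
  by case: (eval_word u c) ce.
- by move=> [cn]; move: c0; rewrite cn.
move=> w' w'I w'n; have [rw' Hw' w'0 w'1] := equation_of_ideal w'I w'n.
apply: leq_trans (degree_le_count _) _; rewrite leqNgt; apply/negP=> lt.
have := lower_bound D_ok QN_ok excl rw' Hw' _ w'0; rewrite -eval_word_prod w'1.
by case=> //; rewrite -ltnS; apply: leq_trans lt _; case: (count _ _).
Qed.

End Equations.

Theorem theorem1 (n : nat) :
  exists p : prog, forall (S : seq (fword n)) (u : fword n),
    let H := generated (map (@fg_of_word n) S) in
    let g := fg_of_word u in
    depends_on H g ->
    exists w : free_prod (free_group n),
      [/\ runs p (enc_input S u) (enc_equation w),
          eqn_ideal H g w,
          w <> 1
        & forall w' : free_prod (free_group n),
            eqn_ideal H g w' -> w' <> 1 -> (degree w <= degree w')%N].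
Proof.
have [p pP] := unbounded_search comp_check comp_output.
exists p => S u H g dep; have [cert /check_sound[w [wE wI w1 w_min]] run] :=
  pP _ (check_complete dep).
by exists w; split=> //; rewrite -wE.
Qed.
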